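(* Let $k\ge 2$ and $k\ge a\ge 1$ be integers. For $n\ge 0$ let $P_{k,a}(n)$ denote the number of lattice paths $L$ that satisfy the special $(k,a)$-conditions, have major index $n$, and are such that for every peak of $L$ the weight and the relative height of the peak have the same parity. Let $W_{k,a}(n)$ denote the number of those partitions enumerated by $B_{k,a}(n)$ in which every even part appears an even number of times. Then for all $n\ge 0$ \[W_{k,a}(n)=P_{k,a}(n).\] Moreover, \[\sum_{n\ge 0}P_{k,a}(n)q^n=\sum_{N_1\ge N_2\ge\cdots\ge N_{k-1}\ge 0}\frac{q^{N_1^2+N_2^2+\cdots+N_{k-1}^2+2N_a+2N_{a+2}+2N_{a+4}+\cdots}}{(q^2;q^2)_{N_1-N_2}\cdots(q^2;q^2)_{N_{k-2}-N_{k-1}}(q^2;q^2)_{N_{k-1}}},\] where the terms $2N_a+2N_{a+2}+2N_{a+4}+\cdots$ run over all indices $j$ with $a\le j\le k-1$ and $j\equiv a\pmod 2$.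
   Context: Partitions: a partition of $n$ is a non-increasing finite sequence $\lambda_1\ge\lambda_2\ge\cdots\ge\lambda_s>0$ of positive integers with sum $n$ (the empty partition is the only partition of $0$). For $k\ge a\ge 1$, $B_{k,a}(n)$ denotes the number of partitions $\lambda_1+\cdots+\lambda_s$ of $n$ such that $\lambda_j-\lambda_{j+k-1}\ge 2$ for all $j$ with $1\le j\le s-k+1$, and at most $a-1$ of the $\lambda_j$ are equal to $1$. Lattice paths: a lattice path is a path in the first quadrant ($x,y\ge 0$, integer vertices) that starts on the $y$-axis (at $x=0$), ends on the $x$-axis, and uses unit steps of three kinds: North-East $(x,y)\to(x+1,y+1)$; South-East $(x,y)\to(x+1,y-1)$; East $(x,0)\to(x+1,0)$, which is allowed only at height $0$. A path is either empty or ends with a South-East step. The height of a vertex $(x,y)$ is $y$ and its weight is $x$. A peak is a vertex preceded by a North-East step and followed by a South-East step. The major index of a path is the sum of the weights of its peaks. A path satisfies the special $(k,a)$-conditions if it starts at height $k-a$ and all its vertices have height less than $k$. The relative height of a peak $(x,y)$ is the largest integer $h$ for which there are two vertices on the path, $(x',y-h)$ and $(x'',y-h)$, with $x'<x<x''$, such that between these two vertices there are no peaks of height $>y$ and every peak of height $y$ has abscissa $\ge x$. Notation: $(q^2;q^2)_m=\prod_{i=1}^{m}(1-q^{2i})$. *)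

(* Defs.v *)
From HB Require Import structures.
From mathcomp Require Import all_boot all_order all_algebra.
From mathcomp Require Import zify.

Set Implicit Arguments.
Unset Strict Implicit.
Unset Printing Implicit Defensive.

Import GRing.Theory.

(** * Partitions *)

Definition is_partition (n : nat) (l : seq nat) : bool :=
  [&& sorted geq l, all (fun p => 0 < p) l & sumn l == n].

(* Parts are indexed from 0, so lambda_j - lambda_(j+k-1) >= 2 reads as below. *)
Definition B_partition (k a n : nat) (l : seq nat) : bool :=
  [&& is_partition n l,
      [forall j : 'I_(size l), (j + (k - 1) < size l) ==>
         (nth 0 l (j + (k - 1)) + 2 <= nth 0 l j)]
    & count_mem 1 l <= a - 1].

Definition W_partition (k a n : nat) (l : seq nat) : bool :=
  B_partition k a n l && all (fun p => ~~ odd p ==> ~~ odd (count_mem p l)) l.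

(* A partition of n has at most n parts, each at most n: see W_count. *)
Definition W (k a n : nat) : nat :=
  #|[set l : n.-bseq 'I_n.+1 | W_partition k a n (map val l)]|.

(** * Lattice paths *)

Inductive step := NorthEast | SouthEast | East.

Definition step_code (s : step) : option bool :=
  match s with NorthEast => Some true | SouthEast => Some false | East => None end.
Definition step_decode (c : option bool) : step :=
  match c with Some true => NorthEast | Some false => SouthEast | None => East end.
Lemma step_codeK : cancel step_code step_decode. Proof. by case. Qed.
HB.instance Definition _ := Finite.copy step (can_type step_codeK).

(* [(y, s)]: the path starting at (0, y) and following the steps [s]. *)
Definition lpath := (nat * seq step)%type.

Definition step_ok (y : nat) (c : step) : bool :=
  match c with NorthEast => true | SouthEast => 0 < y | East => y == 0 end.

Definition step_height (y : nat) (c : step) : nat :=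
  match c with NorthEast => y.+1 | SouthEast => y.-1 | East => y end.

Fixpoint legal (y : nat) (s : seq step) : bool :=
  if s is c :: s' then step_ok y c && legal (step_height y c) s' else true.

(* Every step increases the abscissa by 1, so the vertex of weight x is the
   x-th one, and the vertices have weights 0, ..., [size L.2]. *)
Definition heights (L : lpath) : seq nat := L.1 :: scanl step_height L.1 L.2.
Definition height (L : lpath) (x : nat) : nat := nth 0 (heights L) x.

Definition is_lattice_path (L : lpath) : bool :=
  [&& legal L.1 L.2, height L (size L.2) == 0
    & (L.2 == [::]) || (last East L.2 == SouthEast)].

Definition special (k a : nat) (L : lpath) : bool :=
  (L.1 == k - a) && all (fun y => y < k) (heights L).

Definition is_peak (L : lpath) (x : nat) : bool :=
  [&& 0 < x, nth East L.2 x.-1 == NorthEast & nth East L.2 x == SouthEast].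

Definition major (L : lpath) : nat := \sum_(x < size L.2 | is_peak L x) x.

Definition rel_height_at (L : lpath) (x h : nat) : bool :=
  [exists x' : 'I_(size L.2).+1, exists x'' : 'I_(size L.2).+1,
    [&& x' < x < x'',
        height L x' + h == height L x,
        height L x'' + h == height L x
      & [forall z : 'I_(size L.2), is_peak L z && (x' < z < x'') ==>
           (height L z <= height L x)
           && ((height L z == height L x) ==> (x <= z))]]].

(* Vertices have nonnegative heights, so no candidate h exceeds the height of
   the peak; negative h are irrelevant to the maximum because h = 1 is always a
   candidate at a peak: see rel_height_at1. *)
Definition rel_height (L : lpath) (x : nat) : nat :=
  \max_(h < (height L x).+1 | rel_height_at L x h) h.

Definition P_path (k a n : nat) (L : lpath) : bool :=
  [&& is_lattice_path L, special k a L, major L == n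
    & [forall x : 'I_(size L.2),
         is_peak L x ==> (odd x == odd (rel_height L x))]].

(* A path of major index n with heights below k has fewer than n + k steps:
   see P_count. *)
Definition P (k a n : nat) : nat :=
  #|[set L : 'I_k * (n + k).-bseq step |
       P_path k a n (val L.1, val L.2)]|.

(** * Formal power series with integer coefficients, as coefficient sequences *)

Local Open Scope ring_scope.

(* Coefficients of p / d for d with constant term 1, by expanding
   1 / d = \sum_m (1 - d)^m: see series_divP. *)
Definition series_div (p d : {poly int}) (n : nat) : int :=
  (p * \sum_(m < n.+1) (1 - d) ^+ m)`_n.

(* The family of power series (F i), for i in D, is summable with sum f: each
   coefficient of the finite partial sums is eventually constant. *)
Definition series_sum (I : eqType) (D : pred I) (F : I -> nat -> int)
    (f : nat -> int) : Prop :=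
  forall n : nat, exists2 s : seq I, all D s &
    forall t : seq I, uniq t -> all D t -> {subset s <= t} ->
      \sum_(i <- t) F i n = f n.

Definition q2_poch (m : nat) : {poly int} :=
  \prod_(1 <= i < m.+1) (1 - 'X^(2 * i)).

(* [N_ N j] is N_j for 1 <= j < k; it is 0 for j = k by the default of [nth]. *)
Definition N_ (k : nat) (N : (k - 1).-tuple nat) (j : nat) : nat :=
  nth 0%N N j.-1.

Definition exponent (k a : nat) (N : (k - 1).-tuple nat) : nat :=
  (\sum_(1 <= j < k) N_ N j ^ 2
   + \sum_(a <= j < k | j == a %[mod 2]) 2 * N_ N j)%N.

Definition denominator (k : nat) (N : (k - 1).-tuple nat) : {poly int} :=
  \prod_(1 <= j < k) q2_poch (N_ N j - N_ N j.+1).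

Definition summand (k a : nat) (N : (k - 1).-tuple nat) : nat -> int :=
  series_div 'X^(exponent a N) (denominator N).

(** * Adequacy of the encodings *)

Lemma series_divP (p d : {poly int}) (n : nat) : d`_0 = 1 ->
  \sum_(i < n.+1) d`_i * series_div p d (n - i) = p`_n.
Proof.
move=> d0.
have low (u : {poly int}) m i : u`_0 = 0 -> (i < m)%N -> (u ^+ m)`_i = 0.
  move=> u0; elim: m i => // m IH i im; rewrite exprS coefM big1 // => j _.
  case: (posnP j) => [->|j0]; first by rewrite u0 mul0r.
  by rewrite IH ?mulr0 //; have := ltn_ord j; lia.
have u0 : (1 - d)`_0 = 0 by rewrite coefB coef1 d0 subrr.
have trunc j : (j <= n)%N ->
    series_div p d j = (p * \sum_(m < n.+1) (1 - d) ^+ m)`_j.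
  move=> jn; rewrite /series_div !coefM; apply: eq_bigr => i _; congr (_ * _).
  rewrite !coef_sum -(big_mkord xpredT (fun m => ((1 - d) ^+ m)`_(j - i))).
  rewrite -(big_mkord xpredT (fun m => ((1 - d) ^+ m)`_(j - i))).
  rewrite (big_cat_nat (n := j.+1) (p := n.+1)) //= [X in _ = _ + X]big_nat.
  by rewrite [X in _ = _ + X]big1 ?addr0 // => m mb; apply: low => //; lia.
transitivity ((d * (p * \sum_(m < n.+1) (1 - d) ^+ m))`_n).
  by rewrite coefM; apply: eq_bigr => i _; rewrite trunc // leq_subr.
have -> : d * (p * \sum_(m < n.+1) (1 - d) ^+ m) = p - p * (1 - d) ^+ n.+1.
  rewrite mulrCA -[X in _ = X - _]mulr1 -mulrBr; congr (_ * _).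
  have := subrXX 1 (1 - d) n.+1; rewrite expr1n subKr => ->.
  by congr (_ * _); apply: eq_bigr => i _; rewrite expr1n mul1r.
rewrite coefB coefM big1 ?subr0 // => i _.
by rewrite low ?mulr0 //; lia.
Qed.

Lemma denominator0 (k : nat) (N : (k - 1).-tuple nat) : (denominator N)`_0 = 1.
Proof.
rewrite -horner_coef0 /denominator horner_prod big1 // => j _.
rewrite horner_prod big_nat big1 // => i ib.
rewrite !hornerE expr0n; have -> : (2 * i == 0)%N = false by lia.
by rewrite subr0.
Qed.

Local Close Scope ring_scope.

Lemma W_count (k a n : nat) :
  exists s : seq (seq nat),
    [/\ uniq s, forall l, (l \in s) = W_partition k a n l & size s = W k a n].
Proof.
pose A := [set l : n.-bseq 'I_n.+1 | W_partition k a n (map val l)].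
exists [seq map val (val l) | l : n.-bseq 'I_n.+1 in A]; split.
- rewrite map_inj_uniq ?enum_uniq // => l1 l2 /inj_map e.
  exact/val_inj/e/val_inj.
- move=> l; apply/imageP/idP => [[m mA ->]|Wl].
    by rewrite inE in mA.
  have /andP[/andP[/and3P[_ pos /eqP sn] _] _] := Wl.
  have sz : size l <= n.
    rewrite -sn; elim: (l) pos => //= x s IH /andP[x0 /IH]; lia.
  have bd x : x \in l -> x < n.+1.
    rewrite -sn; elim: (l) => //= y s IH; rewrite inE => /orP[/eqP->|/IH]; lia.
  have sz' : size (map (@inord n) l) <= n by rewrite size_map.
  have e : map val (map (@inord n) l) = l.
    by rewrite -map_comp -[RHS]map_id; apply/eq_in_map => x /bd xn /=; rewrite inordK.
  by exists (Bseq sz'); rewrite ?inE /= e.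
- by rewrite size_map -cardE.
Qed.

Lemma size_heights (L : lpath) : size (heights L) = (size L.2).+1.
Proof. by rewrite /= size_scanl. Qed.

Lemma height0 (L : lpath) : height L 0 = L.1. Proof. by []. Qed.

Lemma heightS (L : lpath) (x : nat) : x < size L.2 ->
  height L x.+1 = step_height (height L x) (nth East L.2 x).
Proof.
case: L => y s; rewrite /height /heights /=.
by elim: s y x => // c s IH y [|x] //= xs; apply: IH.
Qed.

Lemma legalP (L : lpath) (x : nat) : legal L.1 L.2 -> x < size L.2 ->
  step_ok (height L x) (nth East L.2 x).
Proof.
case: L => y s; rewrite /height /heights /=.
elim: s y x => // c s IH y [|x] /= /andP[ok lg] // xs; exact: IH.
Qed.

Lemma rel_height_at1 (L : lpath) (x : nat) : legal L.1 L.2 ->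
  is_peak L x -> rel_height_at L x 1.
Proof.
move=> lg /and3P[x0 /eqP ne /eqP se].
have xs : x < size L.2.
  by rewrite ltnNge; apply/negP => h; rewrite nth_default in se.
have b1 : x.-1 < (size L.2).+1 by lia.
have b2 : x.+1 < (size L.2).+1 by lia.
have h1 : height L x = (height L x.-1).+1.
  by rewrite -{1}(prednK x0) heightS ?ne //; lia.
have h2 : height L x.+1 = (height L x).-1 by rewrite heightS // se.
apply/existsP; exists (Ordinal b1); apply/existsP; exists (Ordinal b2) => /=.
apply/and4P; split; [lia|lia|lia|].
apply/forallP => z; apply/implyP => /andP[_ zx].
have e : nat_of_ord z = x by lia.
by rewrite e !leqnn implybT.
Qed.

Lemma P_path_size (k a n : nat) (L : lpath) :
  P_path k a n L -> size L.2 < n + k.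
Proof.
case/and4P => /and3P[lg /eqP hend hlast] /andP[_ hk] /eqP maj _.
have hb x : x <= size L.2 -> height L x < k.
  by move=> xs; apply: (allP hk); rewrite mem_nth // size_heights.
(* walking back from the end along South-East steps *)
have back j : (j <= size L.2) ->
    (forall i, i < j -> nth East L.2 (size L.2 - i.+1) = SouthEast) ->
    height L (size L.2 - j) = j.
  elim: j => [|j IH] js allS; first by rewrite subn0.
  have sub : (size L.2 - j.+1).+1 = size L.2 - j by lia.
  have lt : size L.2 - j.+1 < size L.2 by lia.
  have := heightS lt; rewrite allS // sub IH //=; last first.
  - by move=> i ij; apply: allS; lia.
  - lia.
  have := legalP lg lt; rewrite allS //=; lia.
have [sz0|sz0] := posnP (size L.2).
  by have := hb 0 (leq0n _); rewrite sz0; lia.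
have lS : nth East L.2 (size L.2 - 1) = SouthEast.
  rewrite subn1 nth_last; case/orP: hlast => /eqP // e.
  by rewrite e in sz0.
have [allS|] := boolP [forall i : 'I_(size L.2), nth East L.2 (size L.2 - i.+1) == SouthEast].
  have := back _ (leqnn _) (fun i iL => eqP (forallP allS (Ordinal iL))).
  by have := hb _ (leq_subr (size L.2) (size L.2)); lia.
rewrite negb_forall => /existsP[i0 i0P].
have ex : exists j, (j < size L.2) && (nth East L.2 (size L.2 - j.+1) != SouthEast).
  by exists i0; rewrite ltn_ord.
case: (ex_minnP ex) => j /andP[jL jP] jmin.
have hS i : i < j -> nth East L.2 (size L.2 - i.+1) = SouthEast.
  move=> ij; apply/eqP/negPn/negP => h.
  by have := jmin i; rewrite h (ltn_trans ij jL) => /(_ isT); lia.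
have j0 : 0 < j by case: (j) jP => //; rewrite lS.
have hj := back j (ltnW jL) hS.
have xs : size L.2 - j.+1 < size L.2 by lia.
have xS : (size L.2 - j.+1).+1 = size L.2 - j by lia.
have ne : nth East L.2 (size L.2 - j.+1) = NorthEast.
  move: (legalP lg xs) (heightS xs) jP; rewrite xS hj.
  by case: nth => //= /eqP -> e; move: j0; rewrite e.
have pk : is_peak L (size L.2 - j).
  rewrite /is_peak; apply/and3P; split; first lia.
    by have -> : (size L.2 - j).-1 = size L.2 - j.+1; [lia | rewrite ne].
  by have := hS j.-1; rewrite prednK // => ->; rewrite ?eqxx //; lia.
have lt : size L.2 - j < size L.2 by lia.
have : size L.2 - j <= n.
  by rewrite -maj /major (bigD1 (Ordinal lt)) //= leq_addr.
have := hb _ (ltnW lt); rewrite hj; lia.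
Qed.

Lemma P_count (k a n : nat) :
  exists s : seq lpath,
    [/\ uniq s, forall L, (L \in s) = P_path k a n L & size s = P k a n].
Proof.
pose A := [set L : 'I_k * (n + k).-bseq step | P_path k a n (val L.1, val L.2)].
pose f (L : 'I_k * (n + k).-bseq step) : lpath := (val L.1, val L.2).
exists [seq f L | L : 'I_k * (n + k).-bseq step in A]; split.
- rewrite map_inj_uniq ?enum_uniq // => -[i1 s1] [i2 s2] [/val_inj -> e].
  by congr pair; apply: val_inj.
- move=> L; apply/imageP/idP => [[m mA ->]|PL]; first by rewrite inE in mA.
  have sz := ltnW (P_path_size PL).
  have /and4P[_ /andP[_ /= /andP[lk _]] _ _] := PL.
  exists (Ordinal lk, Bseq sz); first by rewrite inE -surjective_pairing.
  by rewrite /f /= -surjective_pairing.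
- by rewrite size_map -cardE.
Qed.

(* Main.v *)
(* Two observations carry the proof.

   (1) The relative height of a peak is its drop to the higher of the two
   valleys that bound it, and each valley bounds some peak in this sense; hence
   weight and relative height agree modulo 2 at all peaks iff every maximal run
   of North-East steps starts at an even weight.  In this form the condition is
   local, so that the Burge correspondence carries it to "every even part occurs
   an even number of times", and the generating functions of the paths satisfy
   a recursion obtained by removing two steps.

   (2) Let M_a(z) be the multiple sum with the extra weight z^(N_1).  Away from
   the boundary values of a,
     M_a(z) = M_(a+2)(zq^2) + zq M_a(zq^2) + M_(a-2)(zq^2) + (zq^2 - 1) M_a(zq^4).
   The passage from k - 1 to k, which divides by (z; q^2)_oo and multiplies the
   coefficient of z^N by q^(N^2), preserves this equation; and it is the
   recursion of the paths that start at height k - a, where z marks the peaks. *)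

Require Import Defs.
From mathcomp Require Import all_boot all_order all_algebra.
From mathcomp Require Import qpoly.
From mathcomp Require Import zify ring.

Set Implicit Arguments.
Unset Strict Implicit.
Unset Printing Implicit Defensive.

Import GRing.Theory.

(** * Relative heights and the positions of ascents *)

Definition ascents_even (L : lpath) : Prop :=
  forall x, x < size L.2 -> nth East L.2 x = NorthEast ->
    (0 < x -> nth East L.2 x.-1 <> NorthEast) -> ~~ odd x.

Section PathShape.

Variable L : lpath.
Hypothesis legalL : legal L.1 L.2.
Hypothesis endL : height L (size L.2) = 0.

Local Notation H := (height L).
Local Notation st := (nth East L.2).

Lemma step_cases x : x < size L.2 ->
  [\/ st x = NorthEast /\ H x.+1 = (H x).+1,
      st x = SouthEast /\ H x = (H x.+1).+1
    | [/\ st x = East, H x = 0 & H x.+1 = 0]].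
Proof.
move=> xs; have := legalP legalL xs; rewrite (heightS xs).
case: (st x) => /=; first by constructor 1.
- by move=> h; constructor 2; split=> //; lia.
- by move=> /eqP h; constructor 3.
Qed.

(** The hypothesis rules out East steps, which join two vertices at height 0; the other steps change
    abscissa plus height by 2 or 0. *)
Lemma height_parity x y : x <= y <= size L.2 ->
  (forall z, x <= z < y -> 0 < H z + H z.+1) ->
  odd (x + H x) = odd (y + H y).
Proof.
move=> /andP[]; elim: y => [|y IH]; first by case: x.
rewrite leq_eqVlt => /orP[/eqP->//|]; rewrite ltnS => xy ys pos.
rewrite IH //; [|exact: ltnW|by move=> z zy; apply: pos; lia].
have := pos y; case: (step_cases ys) => [[_ e]|[_ e]|[_ e1 e2]]; lia.
Qed.

Lemma last_below x y v : x <= y <= size L.2 -> H x <= v < H y ->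
  exists2 u, x <= u < y & H u = v /\ forall z, u < z <= y -> v < H z.
Proof.
move=> /andP[]; elim: y => [|y IH].
  by rewrite leqn0 => /eqP->; lia.
rewrite leq_eqVlt => /orP[/eqP<-|]; first lia.
rewrite ltnS => xy ys vb.
have [vy|yv] := ltnP v (H y).
  have [||u ub [uv up]] := IH xy; [lia|lia|].
  exists u; [lia|split=> // z zb].
  by have [->|zy] := eqVneq z y.+1; [lia|apply: up; lia].
exists y; first lia.
split; last by move=> z zb; have -> : z = y.+1; lia.
case: (step_cases ys) => [[_ e]|[_ e]|[_ e1 e2]]; lia.
Qed.

Lemma first_below x y v : x <= y <= size L.2 -> H y <= v < H x ->
  exists2 w, x < w <= y & H w = v /\ forall z, x <= z < w -> v < H z.
Proof.
move=> /andP[]; move dE : (y - x) => d.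
elim: d x dE => [|d IH] x dE xy ys vb.
  by have e : x = y; [lia|rewrite e in vb; lia].
have xs : x < size L.2 by lia.
have [vx|xv] := ltnP v (H x.+1).
  have [||||w wb [wv wp]] := IH x.+1; [lia|lia|lia|lia|].
  exists w; [lia|split=> // z zb].
  by have [->|zx] := eqVneq z x; [lia|apply: wp; lia].
exists x.+1; first lia.
split; last by move=> z zb; have -> : z = x; lia.
case: (step_cases xs) => [[_ e]|[_ e]|[_ e1 e2]]; lia.
Qed.

(** Leftmost, because in the definition of the relative height no peak of the same height may lie to
    the left. *)
Lemma leftmost_max x y : x < y ->
  exists2 m, x <= m < y &
    (forall z, x <= z < y -> H z <= H m) /\ (forall z, x <= z < m -> H z < H m).
Proof.
elim: y => // y IH; rewrite ltnS leq_eqVlt => /orP[/eqP->|xy].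
  by exists y; [lia|split=> z zb; [have -> : z = y by lia|lia]].
have [m mb [m1 m2]] := IH xy.
have [mle|mgt] := leqP (H y) (H m).
  exists m; first lia.
  by split=> // z zb; have [->//|zy] := eqVneq z y; apply: m1; lia.
exists y; first lia.
split=> z zb; last by have := m1 z; lia.
by have [->//|zy] := eqVneq z y; have := m1 z; lia.
Qed.

Lemma hill_peak x y v : x.+1 < y <= size L.2 -> H x = v -> H y = v ->
  (forall z, x < z < y -> v < H z) ->
  exists2 m, x < m < y & [/\ is_peak L m, v < H m,
    forall z, x <= z <= y -> H z <= H m & forall z, x <= z < m -> H z < H m].
Proof.
move=> /andP[xy ys] hx hy pos.
have [m mb [m1 m2]] := leftmost_max xy.
have mv : v < H m by apply: pos; lia.
have m1' z : x <= z <= y -> H z <= H m.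
  move=> zb; have [->|zx] := eqVneq z x; first lia.
  by have [->|zy] := eqVneq z y; [lia|apply: m1; lia].
have m2' z : x <= z < m -> H z < H m.
  by move=> zb; have [->|zx] := eqVneq z x; [lia|apply: m2; lia].
exists m; [lia|split=> //].
have ms : m < size L.2 by lia.
have pms : m.-1 < size L.2 by lia.
have := step_cases ms; have := step_cases pms; rewrite prednK; last lia.
have := m2' m.-1; have := m1' m.+1 => a1 a2.
rewrite /is_peak.
case=> [[-> e]|[-> e]|[-> e1 e2]]; [|lia|lia].
case=> [[-> f]|[-> f]|[-> f1 f2]]; [lia| |lia].
by rewrite !eqxx !andbT; lia.
Qed.

Lemma rel_height_atP x h :
  reflect (exists x' x'', [/\ x' < x < x'', x'' <= size L.2, H x' + h = H x,
      H x'' + h = H x & forall z, is_peak L z -> x' < z < x'' ->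
        H z <= H x /\ (H z = H x -> x <= z)])
    (rel_height_at L x h).
Proof.
apply: (iffP existsP) => [[x1 /existsP[x2]] | [x1 [x2 [xb xs h1 h2 hz]]]].
  case/and4P=> xb /eqP h1 /eqP h2 /forallP hz.
  exists x1, x2; split=> //; first by have := ltn_ord x2; lia.
  move=> z pz zb.
  have zs : z < size L.2 by have := ltn_ord x2; lia.
  have := hz (Ordinal zs); rewrite /= pz zb /= => /andP[a b].
  by split=> // e; move: b; rewrite e eqxx.
have b1 : x1 < (size L.2).+1 by lia.
have b2 : x2 < (size L.2).+1 by lia.
exists (Ordinal b1); apply/existsP; exists (Ordinal b2) => /=.
rewrite xb h1 h2 !eqxx /=; apply/forallP => z; apply/implyP => /andP[pz zb].
have [-> b] := hz _ pz zb.
by apply/implyP => /eqP; apply: b.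
Qed.

Lemma leq_rel_height x h : rel_height_at L x h -> h <= rel_height L x.
Proof.
move=> rh; have [x1 [x2 [_ _ h1 _ _]]] := rel_height_atP _ _ rh.
have hb : h < (H x).+1 by lia.
by rewrite /rel_height (bigD1 (Ordinal hb)) //= leq_maxl.
Qed.

Lemma rel_height_attained x : is_peak L x -> rel_height_at L x (rel_height L x).
Proof.
move=> pk; have a1 := rel_height_at1 legalL pk.
have [x1 [x2 [_ _ h1 _ _]]] := rel_height_atP _ _ a1.
have hb : 1 < (H x).+1 by lia.
rewrite /rel_height.
have [i ri ->] := @eq_bigmax_cond _
  (fun h : 'I_(H x).+1 => rel_height_at L x h) (fun h => h : nat)
  (introT card_gt0P (ex_intro _ (Ordinal hb) a1)).
by [].
Qed.

(** If the parities differed, the vertices u and w where the path leaves and regains the level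
    [H x - h] around x would have odd abscissa. No ascent starts at either, so the path climbs into
    u and falls beyond w, and h + 1 would be a candidate too. *)
Lemma rel_height_parity x : ascents_even L -> is_peak L x ->
  odd x = odd (rel_height L x).
Proof.
move=> asc pk; have at_h := rel_height_attained pk.
set h := rel_height L x in at_h *.
have h0 : 0 < h by apply: leq_rel_height (rel_height_at1 legalL pk).
have [x1 [x2 [/andP[x1x xx2] x2s h1 h2 hz]]] := rel_height_atP _ _ at_h.
have xs : x < size L.2 by lia.
have [||u ub [uv up]] := @last_below x1 x (H x - h); [lia|lia|].
have [||w wb [wv wp]] := @first_below x x2 (H x - h); [lia|lia|].
have ox : odd (u + H u) = odd (x + H x).
  by apply: height_parity => [|z zb]; [lia|have := up z.+1; lia].
have ow : odd (x + H x) = odd (w + H w).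
  by apply: height_parity => [|z zb]; [lia|have := wp z; lia].
apply/eqP/negPn/negP => /eqP bad.
have oddu : odd u by lia.
have us : u < size L.2 by lia.
have pus : u.-1 < size L.2 by lia.
have u0 : 0 < u by case: (u) oddu.
have stu : st u = NorthEast.
  by have := up u.+1; case: (step_cases us) => [[]//|[_ e]|[_ e1 e2]]; lia.
have stu1 : st u.-1 = NorthEast.
  apply/eqP/negPn/negP => /eqP ne.
  by have := asc u us stu (fun _ => ne); rewrite oddu.
have hu : H u = (H u.-1).+1.
  by have := step_cases pus; rewrite prednK // stu1 => -[[]|[]|[]].
have ws : w < size L.2.
  rewrite ltn_neqAle; apply/andP; split; last lia.
  by apply/eqP => e; move: wv; rewrite e endL; lia.
have pws : w.-1 < size L.2 by lia.
have stw1 : st w.-1 = SouthEast.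
  have := step_cases pws; have := wp w.-1; rewrite prednK; last lia.
  by move=> ? [[_ e]|[-> _]//|[_ e1 e2]]; lia.
have hw : H w = (H w.+1).+1.
  case: (step_cases ws) => [[e _]|[_ e]//|[_ e _]]; last lia.
  have ne : st w.-1 <> NorthEast by rewrite stw1.
  by have := asc w ws e (fun _ => ne); lia.
have : h.+1 <= h; last by rewrite ltnn.
apply: leq_rel_height; apply/rel_height_atP; exists u.-1, w.+1.
split; [lia|lia|lia|lia|].
move=> z pz zb.
have [zu|zu] := eqVneq z u.
  by move: pz; rewrite zu /is_peak stu !andbF.
have [zw|zw] := eqVneq z w.
  by move: pz; rewrite zw /is_peak stw1 andbF.
by apply: hz => //; lia.
Qed.

(** Suppose that an ascent starts at an odd v. The hill right of v has a peak r whose drop to v has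
    the wrong parity, so the relative height of r reaches below v; hence v is a valley, with a lower
    peak l on its left. The same parity argument makes the window of l extend over r, which is
    higher than l. *)
Lemma parity_ascents_even :
  (forall x, is_peak L x -> odd x = odd (rel_height L x)) -> ascents_even L.
Proof.
move=> par v vs stv pre; apply/negP => oddv.
have v0 : 0 < v by case: (v) oddv.
have {}pre := pre v0.
have hv1 : H v.+1 = (H v).+1.
  by case: (step_cases vs) => [[_ ->]//|[e _]|[e _ _]]; rewrite stv in e.
have [||w wb [wv wp]] := @first_below v.+1 (size L.2) (H v); [lia|by rewrite endL; lia|].
have wp' z : v < z < w -> H v < H z by move=> zb; apply: wp; lia.
have [||||r rb [pr hr r1 r2]] := @hill_peak v w (H v); [lia|by []|by []|exact: wp'|].
have geR z : v <= z <= w -> H v <= H z.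
  move=> zb; have [->//|zv] := eqVneq z v; have [->|zw] := eqVneq z w; first lia.
  by apply/ltnW/wp; lia.
have orv : odd (v + H v) = odd (r + H r).
  by apply: height_parity => [|z zb]; [lia|have := wp z.+1; lia].
have atR : rel_height_at L r (H r - H v).
  apply/rel_height_atP; exists v, w; split; try lia.
  by move=> z _ zb; split; [apply: r1; lia|have := r2 z; lia].
have := leq_rel_height atR; rewrite leq_eqVlt => /orP[/eqP e|gt].
  by have := par _ pr; rewrite -e; lia.
have [x1 [x2 [xb xs h1 h2 hz]]] := rel_height_atP _ _ (rel_height_attained pr).
have x1v : x1 < v by have := geR x1; lia.
have x2w : w < x2 by have := geR x2; lia.
have pvs : v.-1 < size L.2 by lia.
(* The vertex at x1 is lower than v, so v is not on the axis and the step before it is not East. *)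
have hv : H v.-1 = (H v).+1.
  by have := step_cases pvs; rewrite prednK // => -[[e _]//|[_ e]//|[_ e1 e2]]; lia.
have [||u ub [uv up]] := @last_below x1 v.-1 (H v); [lia|lia|].
have up' z : u < z < v -> H v < H z by move=> zb; apply: up; lia.
have [||||l lb [pl hl l1 l2]] := @hill_peak u v (H v); [lia|by []|by []|exact: up'|].
have lr : H l < H r.
  by have [|a b] := hz l pl; [lia|rewrite ltn_neqAle a andbT; apply/eqP => /b; lia].
have olv : odd (l + H l) = odd (v + H v).
  by apply: height_parity => [|z zb]; [lia|have := up' z; lia].
have atL : rel_height_at L l (H l - H v).
  apply/rel_height_atP; exists u, v; split; try lia.
  by move=> z _ zb; split; [apply: l1; lia|have := l2 z; lia].
have := leq_rel_height atL; rewrite leq_eqVlt => /orP[/eqP e|gtl].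
  by have := par _ pl; rewrite -e; lia.
have [y1 [y2 [yb ys k1 k2 kz]]] := rel_height_atP _ _ (rel_height_attained pl).
have y2w : w < y2.
  have [vy|yv] := leqP v y2; first by have := geR y2; lia.
  by have := up' y2; lia.
by have [|le _] := kz r pr; [lia|lia].
Qed.

End PathShape.

(** * Recursive description of the paths *)

(** Barring East from the last place suffices: a North-East step cannot end at height 0. *)
Fixpoint good_path (k y : nat) (s : seq step) : bool :=
  (y < k) && if s is c :: s' then
    [&& step_ok y c, (c == East) ==> (s' != [::])
      & good_path k (step_height y c) s']
  else y == 0.

(* [pk p s] and [mj p s] count the peaks and sum their weights in a path [s],
   preceded by a North-East step if [p]; [mj] measures weights from the start
   of [s], and [e] in [ascents_at p e s] is the parity of its actual weight. *)
Fixpoint pk (p : bool) (s : seq step) : nat :=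
  if s is c :: s' then (p && (c == SouthEast)) + pk (c == NorthEast) s' else 0.

Fixpoint mj (p : bool) (s : seq step) : nat :=
  if s is c :: s' then mj (c == NorthEast) s' + pk (c == NorthEast) s' else 0.

Fixpoint ascents_at (p e : bool) (s : seq step) : bool :=
  if s is c :: s' then
    ((c == NorthEast) ==> (p || ~~ e)) && ascents_at (c == NorthEast) (~~ e) s'
  else true.

Lemma ascents_atP c0 e s :
  reflect (forall x, x < size s -> nth East s x = NorthEast ->
             nth East (c0 :: s) x <> NorthEast -> ~~ (e (+) odd x))
    (ascents_at (c0 == NorthEast) e s).
Proof.
elim: s c0 e => [|c s IH] c0 e /=; first by constructor.
apply: (iffP andP) => [[h1 /IH h2] [|x] /= xs cx pre|h].
- by move: h1; rewrite cx eqxx /= addbF (introF eqP pre).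
- by have := h2 x xs cx pre; case: e {h1 h2}; case: odd.
split.
  apply/implyP => /eqP ce; have := h 0 isT ce; rewrite /= addbF.
  by case: eqP => // ne /(_ ne).
by apply/IH => x xs cx pre; have := h x.+1 xs cx pre; rewrite /= addbN addNb.
Qed.

Lemma ascents_evenP y s : reflect (ascents_even (y, s)) (ascents_at false false s).
Proof.
apply: (iffP (ascents_atP East false s)) => h x xs cx pre.
  by apply: h => //; case: x xs cx pre => [|x] // _ _; apply.
by apply: (h x) => //; case: x xs cx pre.
Qed.

Lemma good_pathE k y s : good_path k y s =
  [&& legal y s, height (y, s) (size s) == 0,
      (s == [::]) || (last East s == SouthEast)
    & all (fun z => z < k) (heights (y, s))].
Proof.
elim: s y => [|c s IH] y /=; first by rewrite !andbT andbC.
have -> : height (y, c :: s) (size s).+1 = height (step_height y c, s) (size s) by [].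
rewrite IH {IH} /=.
have [h0|] := eqVneq (height _ _) 0; last by rewrite /= !andbF.
have -> : (last c s == SouthEast) =
    ((c == East) ==> (s != [::])) && ((s == [::]) || (last East s == SouthEast)).
  by case: s h0 => [|d s] //=; case: c; rewrite ?andbT.
case: (y < k); last by rewrite /= !andbF.
case: (step_ok y c); case: (legal _ s); case: (_ ==> _); case: (_ || _) => //=;
  by rewrite ?andbF ?andbT.
Qed.

Lemma pkE c0 s : pk (c0 == NorthEast) s =
  \sum_(x < size s)
    ((nth East (c0 :: s) x == NorthEast) && (nth East s x == SouthEast)).
Proof.
elim: s c0 => [|c s IH] c0 /=; first by rewrite big_ord0.
by rewrite big_ord_recl /= IH.
Qed.

Lemma mjE c0 s : mj (c0 == NorthEast) s =
  \sum_(x < size s)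
    ((nth East (c0 :: s) x == NorthEast) && (nth East s x == SouthEast)) * x.
Proof.
elim: s c0 => [|c s IH] c0 /=; first by rewrite big_ord0.
rewrite big_ord_recl /= muln0 add0n IH pkE -big_split /=.
by apply: eq_bigr => i _; rewrite /bump /= mulnS addnC.
Qed.

Lemma majorE y s : major (y, s) = mj false s.
Proof.
rewrite (mjE East) /major big_mkcond /=; apply: eq_bigr => -[[|x] xs] _ //=.
by rewrite /is_peak /=; case: (_ && _); rewrite ?mul1n ?mul0n.
Qed.

Lemma P_pathE k a n y s :
  P_path k a n (y, s) =
  [&& y == k - a, good_path k y s, ascents_at false false s & mj false s == n].
Proof.
rewrite good_pathE /P_path /is_lattice_path /special majorE /=.
have [lg|] := boolP (legal y s); last by rewrite /= !andbF.
have [h0|] := eqVneq (height _ _) 0; last by rewrite /= !andbF.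
rewrite /= -!andbA; case: (_ || _); last by rewrite !andbF.
case: (y == _) => //=; case: (_ < k) => //=; case: (all _ _) => //=.
rewrite andbC; congr (_ && _).
apply/forallP/(ascents_evenP y) => [par|asc x].
  apply: parity_ascents_even => // x pkx.
  have xs : x < size s.
    case/and3P: pkx => _ _ /eqP /= sx.
    by rewrite ltnNge; apply/negP => h; rewrite nth_default in sx.
  by have := par (Ordinal xs); rewrite /= pkx => /eqP.
by apply/implyP => pkx; apply/eqP; apply: rel_height_parity.
Qed.

(** * The Burge correspondence *)

(* A list [f] is the sequence of multiplicities of the parts 1, 2, ...; the
   height of the path plays the role of the multiplicity of a part 0.  Removing
   the first step of a path lowers one part in each of the pairs (i, i + 1) that
   greedily cover, from the largest part down, the parts that occur; the step
   is North-East when (0, 1) is such a pair.  [unstep b] is the inverse move,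
   which raises one part in each pair, found greedily from the left: [b] tells
   whether the head of [f] is the upper element of a pair. *)
Fixpoint unstep (b : bool) (f : seq nat) : seq nat :=
  if f is x :: t then
    if b then x.+1 :: unstep false t
    else if x is x'.+1 then x' :: unstep true t else 0 :: unstep false t
  else nseq b 1.

Fixpoint uppers (b : bool) (f : seq nat) : nat :=
  if f is x :: t then b + uppers (~~ b && (if x is 0 then false else true)) t else b.

Definition cons_trim (x : nat) (t : seq nat) : seq nat :=
  if (x == 0) && (t == [::]) then [::] else x :: t.

Fixpoint dstep (f : seq nat) : bool * seq nat :=
  if f is x :: t then
    let: (b, t') := dstep t in
    if b then (false, x.+1 :: t')
    else if x is x'.+1 then (true, cons_trim x' t') else (false, cons_trim 0 t')
  else (false, [::]).

Definition burge (s : seq step) : seq nat :=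
  foldr (fun c f => unstep (c == NorthEast) f) [::] s.

(** The default 1 makes the empty list trimmed. Without trailing zeros a partition has a single list
    of multiplicities. *)
Definition trimmed (f : seq nat) : bool := last 1 f != 0.

Fixpoint wt (i : nat) (f : seq nat) : nat :=
  if f is x :: t then i * x + wt i.+1 t else 0.

(** The list starts with the part 1, so [y] is the multiplicity of an even part. *)
Fixpoint even_part_ok (f : seq nat) : bool :=
  if f is x :: y :: t then ~~ odd y && even_part_ok t else true.

(** For y = k - a, the first inequality of the path bounds the number of ones by a - 1; the others
    are the difference condition. *)
Definition multiplicities_ok (k y : nat) (f : seq nat) : bool :=
  [&& trimmed f, y < k & path (fun u v => u + v < k) y f].

Lemma trimmed_behead x t : trimmed (x :: t) -> trimmed t.
Proof. by case: t. Qed.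

Lemma cons_trimE x t : trimmed (x :: t) -> cons_trim x t = x :: t.
Proof. by rewrite /cons_trim /trimmed; case: t => [/negPf/= ->|y t]; rewrite ?andbF. Qed.

Lemma trimmed_cons_trim x t : trimmed t -> trimmed (cons_trim x t).
Proof.
rewrite /cons_trim; case: t => [|y t] //=; last by rewrite andbF.
by rewrite andbT; case: eqP => //= /eqP.
Qed.

Lemma unstep_nil b f : trimmed f -> unstep b f = [::] -> b = false /\ f = [::].
Proof. by case: f b => [|[|x] t] [] //=. Qed.

Lemma trimmed_unstep b f : trimmed f -> trimmed (unstep b f).
Proof.
elim: f b => [|x t IH] b tr; first by case: b.
have trt := trimmed_behead tr.
have aux c z : (z = 0 -> c = false -> x = 0) -> trimmed (z :: unstep c t).
  move=> zx; have := IH c trt; rewrite /trimmed /=.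
  case e : (unstep c t) => [|w u] //= _; apply/eqP => z0.
  have [c0 t0] := unstep_nil trt e.
  by move: tr; rewrite t0 (zx z0 c0).
by case: b => //=; [apply: aux|case: x {tr} aux => [|x] aux; apply: aux].
Qed.

Lemma unstepK b f : trimmed f -> dstep (unstep b f) = (b, f).
Proof.
elim: f b => [|x t IH] b tr; first by case: b.
have trt := trimmed_behead tr.
case: b => /=; first by rewrite IH // cons_trimE.
by case: x tr => [|x] tr /=; rewrite IH // cons_trimE.
Qed.

Lemma dstepK f : trimmed f -> unstep (dstep f).1 (dstep f).2 = f.
Proof.
elim: f => // x t IH tr; have := IH (trimmed_behead tr).
rewrite /=; case: (dstep t) => -[] t' /= e; first by rewrite e.
rewrite /cons_trim; case: x tr => [|x] tr; case: t' e => [|z u] /= e.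
- by rewrite -e in tr.
- by rewrite e.
- by case: x {tr} => [|x]; rewrite -e.
- by rewrite andbF /= e.
Qed.

Lemma trimmed_dstep f : trimmed f -> trimmed (dstep f).2.
Proof.
elim: f => // x t IH tr; have := IH (trimmed_behead tr).
rewrite /=; case: (dstep t) => -[] t' /= tr'; first by case: t' tr'.
by case: x {tr} => [|x]; apply: trimmed_cons_trim.
Qed.

Lemma trimmed_burge s : trimmed (burge s).
Proof. by elim: s => //= c s IH; apply: trimmed_unstep. Qed.

(** Each pair moves one part up by 1. If [b] holds, one of these comes from the part i in front of
    the list, whose weight was not counted. *)
Lemma wt_unstep i b f : wt i.+1 (unstep b f) = wt i.+1 f + uppers b f + b * i.
Proof.
elim: f i b => [|x t IH] i b /=; first by case: b => /=; lia.
by case: b => /=; [rewrite IH|case: x => [|x] /=; rewrite IH]; rewrite ?mulnS ?muln0 /=; lia.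
Qed.

(** This mirrors the creation of a peak, where a North-East step meets one that is not
    North-East. *)
Lemma uppers_unstep p b f : uppers p (unstep b f) = uppers b f + (p && ~~ b).
Proof.
elim: f p b => [|x t IH] p b /=; first by case: p; case: b.
case: b => /=; first by rewrite IH; case: p => /=; lia.
case: x => [|x] /=; first by rewrite andbF IH; case: p => /=; lia.
by rewrite IH; case: p => /=; rewrite ?andbF ?andbT /=; lia.
Qed.

(** While the two carries satisfy [b2 ==> b1], an even multiplicity of an even part changes by 0 or
    2 and passes on carries with the same property. Otherwise the failure persists in the carries or
    surfaces as an odd entry. *)
Lemma even_part_ok_unstep2 b1 b2 f :
  even_part_ok (unstep b1 (unstep b2 f)) = (b2 ==> b1) && even_part_ok f.
Proof.
have [n] := ubnP (size f); elim: n f b1 b2 => // n IH [|x [|y t]] b1 b2 /= szf.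
- by case: b1; case: b2.
- by case: b2 => /=; [|case: x => [|[|x]]]; case: b1.
have {}IH c1 c2 : even_part_ok (unstep c1 (unstep c2 t)) = (c2 ==> c1) && even_part_ok t.
  by apply: IH; lia.
(* Two moves lower an entry by at most 2, so the values 0, 1 and at least 2 decide the carries. *)
case: b2 => /=; [|case: x => [|[|x]]]; case: b1; case: y szf => [|[|y]] _ /=;
  by rewrite ?IH /= ?negbK ?andbF ?andbT.
Qed.

Lemma even_part_ok_burge p s : even_part_ok (burge s) = ascents_at p false s.
Proof.
have [n] := ubnP (size s); elim: n p s => // n IH p [|c1 [|c2 s]] //= szs.
- by rewrite orbT implybT; case: eqP.
rewrite even_part_ok_unstep2 orbT implybT orbF /= -IH //; lia.
Qed.

Section PathPreserved.
Variable k : nat.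
Local Notation e := (fun u v => u + v < k).

(** Inside a pair the sum is unchanged. The entry after a raised one is lowered unless it is 0,
    whence the slack [u <= u'.+1]. *)
Lemma path_unstep f : (forall u, 0 < u < k -> path e u f -> path e u.-1 (unstep true f))
  /\ (forall u u', u <= u'.+1 -> u < k -> path e u' f -> path e u (unstep false f)).
Proof.
elim: f => [|x t [IHt IHf]]; split=> //=.
- by move=> u u0; rewrite andbT; lia.
- move=> u u0 /andP[ux pt]; apply/andP; split; first lia.
  by apply: IHf pt; lia.
- move=> u u' uu uk /andP[ux pt]; case: x ux pt => [|x] ux pt /=.
    by apply/andP; split; [lia|apply: IHf pt; lia].
  by apply/andP; split; [lia|apply: (IHt x.+1) => //; lia].
Qed.

Lemma unstep_path f : (forall u, path e u (unstep true f) -> path e u.+1 f)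
  /\ (forall u, u < k -> path e u (unstep false f) -> path e u.-1 f).
Proof.
elim: f => [|x t [IHt IHf]]; split=> //=.
- move=> u /andP[ux pt]; apply/andP; split; first lia.
  by apply: (IHf x.+1) => //; lia.
- move=> u uk; case: x => [|x] /= /andP[ux pt]; apply/andP; split; try lia.
  + by apply: (IHf 0) => //; lia.
  (* The head of [unstep true t] is positive and its sum with x is below k. *)
  + have : x.+1 < k; last lia.
    by case: (t) pt => [|z v] /= /andP[]; lia.
  + exact: IHt.
Qed.

End PathPreserved.

(** * Image, statistics and bijectivity of the Burge map *)

Lemma multiplicities_ok_burge k y s : good_path k y s -> multiplicities_ok k y (burge s).
Proof.
rewrite /multiplicities_ok trimmed_burge.
elim: s y => [|c s IH] y /=; first by case/andP => ->.
case/and4P=> yk ok _ /IH /and3P[_ yk' pt]; rewrite yk /=.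
case: c ok yk' pt => /= ok yk' pt.
- by apply: (proj1 (path_unstep _ _) y.+1).
- by apply: (proj2 (path_unstep _ _) y y.-1) => //; lia.
- by apply: (proj2 (path_unstep _ _) y y) => //; lia.
Qed.

Lemma uppers_burge k y (p : bool) s : good_path k y s -> p <= y -> uppers p (burge s) = pk p s.
Proof.
elim: s y p => [|c s IH] y p /=; first by case: p => //= /andP[_ /eqP->].
case/and4P=> yk ok _ gd py; rewrite uppers_unstep.
rewrite (IH _ _ gd); last by case: c ok {gd} => //=; lia.
by rewrite addnC; congr (_ + _); case: p py; case: c ok {gd IH} => //= /eqP->.
Qed.

Lemma wt_burge k y (p : bool) s : good_path k y s -> p <= y -> wt 1 (burge s) = mj p s.
Proof.
elim: s y p => [|c s IH] y p //= /and4P[yk ok _ gd] py.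
have cy : (c == NorthEast) <= step_height y c by case: c ok {gd}.
by rewrite wt_unstep (IH _ _ gd cy) (uppers_burge gd cy) muln0 addn0.
Qed.

Lemma burge_nil k y s : good_path k y s -> burge s = [::] -> s = nseq y SouthEast.
Proof.
elim: s y => [|c s IH] y /=; first by case/andP=> _ /eqP->.
case/and4P=> yk ok nE gd /(unstep_nil (trimmed_burge _)) [cN bs].
have es := IH _ gd bs.
case: c cN ok nE gd es => //= _ ok nE gd es; first by case: y ok es {yk gd} => //= y _ ->.
by move: nE; rewrite es (eqP ok).
Qed.

(** [dstep] recovers whether the first step is North-East; if not, the height decides between
    South-East and East. *)
Lemma burge_inj k y s1 s2 : good_path k y s1 -> good_path k y s2 ->
  burge s1 = burge s2 -> s1 = s2.
Proof.
elim: s1 y s2 => [|c1 s1 IH] y s2 g1 g2 eb.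
  by rewrite (burge_nil g1) // (burge_nil g2).
case: s2 g2 eb => [|c2 s2] g2 eb; first by rewrite (burge_nil g1) // (burge_nil g2).
move: eb => /= /(congr1 dstep); rewrite !unstepK ?trimmed_burge // => -[ec eb].
move: g1 g2 => /= /and4P[_ ok1 _ g1] /and4P[_ ok2 _ g2].
have e12 : c1 = c2.
  case: c1 ec ok1 {g1} => //=; case: c2 ok2 {g2} => //= h1 _ h2; lia.
rewrite e12 in g1 *; congr (_ :: _).
exact: IH g1 g2 eb.
Qed.

Lemma uppers_eq0 b f : trimmed f -> uppers b f = 0 -> f = [::] /\ b = false.
Proof.
elim: f b => [|x t IH] b tr /=; first by case: b.
case: b => //=; rewrite add0n => /(IH _ (trimmed_behead tr))[t0].
by move: tr; rewrite t0; case: x.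
Qed.

(** Induction on the weight: [dstep] lowers it by the number of pairs, which is positive unless the
    list is empty. *)
Lemma burge_onto k y f : multiplicities_ok k y f ->
  exists2 s, good_path k y s & burge s = f.
Proof.
have [n] := ubnP (wt 1 f); elim: n f y => // n IH f y wf /and3P[tr yk pt].
have [f0|f0] := eqVneq f [::].
  rewrite f0; exists (nseq y SouthEast); last by elim: (y) => //= m ->.
  elim: (y) yk => [|m IHm] mk /=; first by rewrite mk.
  by rewrite mk IHm //; lia.
have := dstepK tr; have := trimmed_dstep tr; case: (dstep f) => b f' /= tr' e.
have wf' : wt 1 f' < n.
  have := wt_unstep 0 b f'; rewrite e muln0.
  have : uppers b f' <> 0; last lia.
  by move=> /(uppers_eq0 tr')[z1 z2]; move: f0; rewrite -e z1 z2.
pose c := if b then NorthEast else if 0 < y then SouthEast else East.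
have cb : (c == NorthEast) = b by rewrite /c; case: (b); case: (y).
have okc : step_ok y c by rewrite /c; case: (b); case: (y).
have [|s gs bs] := IH f' (step_height y c) wf'.
  rewrite /multiplicities_ok tr' /=; move: pt; rewrite -e /c.
  case: (b) => /= pt.
    rewrite (proj1 (unstep_path _ _) y) // andbT.
    by case: (f') pt => [|z t] /= /andP[]; lia.
  have := proj2 (unstep_path k f') y yk pt.
  by case: (y) yk => [|m] mk -> /=; rewrite andbT // ltnW.
exists (c :: s); last by rewrite /= bs cb.
rewrite /= yk okc gs andbT /=; apply/implyP => /eqP cE; apply/eqP => s0.
by move: f0; rewrite -e -bs s0 -cb cE.
Qed.

(** * Partitions and their multiplicities *)

Lemma geq_trans : transitive geq.
Proof. by move=> y x z xy yz; apply: leq_trans yz xy. Qed.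

Fixpoint parts (i : nat) (f : seq nat) : seq nat :=
  if f is x :: t then parts i.+1 t ++ nseq x i else [::].

Lemma count_parts i f j :
  count_mem j (parts i f) = if i <= j then nth 0 f (j - i) else 0.
Proof.
elim: f i => [|x t IH] i /=; first by rewrite nth_nil if_same.
rewrite count_cat IH count_nseq /=.
have [ij|ji|e] := ltngtP i j; last first.
- by rewrite e subnn /= mul1n.
- by rewrite mul0n.
- by rewrite -(subnSK ij) /= mul0n addn0.
Qed.

Lemma sumn_parts i f : sumn (parts i f) = wt i f.
Proof. by elim: f i => //= x t IH i; rewrite sumn_cat IH sumn_nseq addnC. Qed.

Lemma all_parts i f : all (leq i) (parts i f).
Proof.
elim: f i => //= x t IH i; rewrite all_cat all_nseq leqnn orbT andbT.
by apply: sub_all (IH i.+1) => z /=; apply: ltnW.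
Qed.

Lemma sorted_parts i f : sorted geq (parts i f).
Proof.
elim: f i => //= x t IH i; rewrite (sorted_pairwise geq_trans) pairwise_cat.
rewrite -!(sorted_pairwise geq_trans) IH /=; apply/andP; split.
  apply/allrelP => u v /(allP (all_parts _ _)) ui; rewrite mem_nseq.
  by case/andP=> _ /eqP->; apply: ltnW.
by case: x => //= x; elim: x => //= x ->; rewrite leqnn.
Qed.

Lemma parts_inj f g : trimmed f -> trimmed g -> parts 1 f = parts 1 g -> f = g.
Proof.
move=> tf tg e.
have nthE i : nth 0 f i = nth 0 g i.
  have := congr1 (count_mem i.+1) e.
  by rewrite !count_parts /= subn1.
have szle f' g' : trimmed f' -> (forall i, nth 0 f' i = nth 0 g' i) ->
    size f' <= size g'.
  move=> tf' h; rewrite leqNgt; apply/negP => lt.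
  move: tf'; rewrite /trimmed; have := h (size f').-1.
  rewrite [RHS]nth_default; last by lia.
  by case: f' lt {h} => //= x t _; rewrite -(last_nth 0) => ->.
apply: (@eq_from_nth _ 0) => [|i _]; last exact: nthE.
by apply/eqP; rewrite eqn_leq !szle.
Qed.

Lemma sorted_geq_eq l m : sorted geq l -> sorted geq m ->
  (forall j, count_mem j l = count_mem j m) -> l = m.
Proof.
move=> sl sm h; apply: (@sorted_eq _ geq) => //.
- exact: geq_trans.
- by move=> x y /= /andP[xy yx]; apply/eqP; rewrite eqn_leq xy yx.
- by apply/allP => j _ /=; rewrite h.
Qed.

Lemma parts_onto n l : is_partition n l -> exists2 f, trimmed f & parts 1 f = l.
Proof.
case/and3P=> sl pos _.
(* The largest part [head 0 l] occurs, so the last multiplicity is nonzero. *)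
exists [seq count_mem i l | i <- iota 1 (head 0 l)].
  case: l sl pos => [|x l] // sl /andP[/= x0 _].
  case: x {x0 sl} => // x; have e : iota 1 x.+1 = iota 1 x ++ [:: x.+1].
    by rewrite -[in LHS](addn1 x) iotaD.
  by rewrite /trimmed e map_cat last_cat /= eqxx.
apply: sorted_geq_eq => [||j]; [exact: sorted_parts|by []|].
rewrite count_parts; case: j => [|j] /=.
  by apply/esym/count_memPn; apply/negP => /(allP pos).
rewrite subn1 /=; have [jh|hj] := ltnP j (head 0 l).
  by rewrite (nth_map 0) ?size_iota // nth_iota.
rewrite nth_default ?size_map ?size_iota //.
apply/esym/count_memPn; apply/negP.
case: l sl hj {pos} => [|x l] //= sl hj; rewrite inE => /orP[/eqP e|jl]; first by lia.
by have := allP (order_path_min geq_trans sl) _ jl => /=; lia.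
Qed.

Lemma nth_sorted_geq l i v : sorted geq l -> i < size l ->
  (v <= nth 0 l i) = (i < count (leq v) l).
Proof.
elim: l i => // x l IH i sl il.
have {}sl' := path_sorted sl.
have [vx|xv] := leqP v x.
  by rewrite /= vx; case: i il => [|i] il //=; rewrite add1n ltnS IH.
have cl : count (leq v) l = 0.
  apply/eqP; rewrite -leqn0 leqNgt -has_count; apply/hasPn => y yl.
  by have := allP (order_path_min geq_trans sl) _ yl => /=; lia.
have nvx : (v <= x) = false by rewrite leqNgt xv.
by rewrite /= cl nvx; case: i il => [|i] il /=; rewrite ?nvx // IH // cl.
Qed.

Lemma count_geqS v l : count (leq v) l = count_mem v l + count (leq v.+1) l.
Proof.
elim: l => //= x l ->; rewrite eq_sym.
by have [] := ltngtP v x => /=; lia.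
Qed.

(** The difference condition fails exactly when k consecutive parts take only two adjacent
    values. *)
Lemma difference_condP k l : 0 < k -> sorted geq l -> all (leq 1) l ->
  reflect (forall v, count_mem v.+1 l + count_mem v.+2 l < k)
    [forall j : 'I_(size l), (j + (k - 1) < size l) ==>
         (nth 0 l (j + (k - 1)) + 2 <= nth 0 l j)].
Proof.
move=> k0 sl pos; apply: (iffP forallP) => [h v|h j].
  rewrite ltnNge; apply/negP => kc.
  have cE := count_geqS v.+1 l; rewrite (count_geqS v.+2) in cE.
  (* The parts equal to v + 1 or v + 2 form the block that starts at index j. *)
  set j := count (leq v.+3) l in cE.
  have jkc : j + (k - 1) < count (leq v.+1) l by lia.
  have jks : j + (k - 1) < size l by apply: leq_trans jkc (count_size _ _).
  have js : j < size l by lia.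
  have := h (Ordinal js); rewrite /= jks /=.
  have : v.+1 <= nth 0 l (j + (k - 1)) by rewrite nth_sorted_geq.
  have : ~~ (v.+3 <= nth 0 l j) by rewrite nth_sorted_geq // ltnn.
  lia.
apply/implyP => jks; rewrite leqNgt; apply/negP => lt.
have pos_v : 0 < nth 0 l (j + (k - 1)) by apply: (allP pos); rewrite mem_nth.
set v := nth 0 l (j + (k - 1)) in lt pos_v.
have : j + (k - 1) < count (leq v) l by rewrite -nth_sorted_geq.
have : ~~ (v.+2 <= nth 0 l j) by lia.
rewrite nth_sorted_geq // (count_geqS v) (count_geqS v.+1).
by have := h v.-1; rewrite prednK //; lia.
Qed.

Lemma path_sum_ltP k y f : y < k ->
  reflect (y + nth 0 f 0 < k /\ forall i, nth 0 f i + nth 0 f i.+1 < k)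
    (path (fun u v => u + v < k) y f).
Proof.
elim: f y => [|x t IH] y yk /=.
  by constructor; split=> [|i]; rewrite ?nth_nil addn0 //; lia.
have [xk|kx] := ltnP x k; last first.
  by rewrite [y + x < k]ltnNge (leq_trans kx) ?leq_addl //; constructor => -[].
apply: (iffP andP) => [[yx /(IH _ xk)[h0 h]]|[yx h]].
  by split=> // -[].
split=> //; apply/(IH _ xk).
by split=> [|i]; [apply: (h 0)|apply: (h i.+1)].
Qed.

Lemma even_part_okP f :
  reflect (forall i, odd i -> ~~ odd (nth 0 f i)) (even_part_ok f).
Proof.
have [n] := ubnP (size f); elim: n f => // n IH [|x [|y t]] /= szf.
- by constructor=> i; rewrite nth_nil.
- by constructor=> -[|i] //= _; rewrite nth_nil.
have /IH{}IH : size t < n by lia.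
apply: (iffP andP) => [[oy /IH h] [|[|i]] //= oi|h].
  by apply: h; rewrite negbK in oi.
split; first exact: (h 1).
by apply/IH => i oi; apply: (h i.+2); rewrite /= negbK.
Qed.

Lemma W_partitionE k a n f : 1 <= a <= k -> trimmed f ->
  W_partition k a n (parts 1 f) =
  [&& multiplicities_ok k (k - a) f, even_part_ok f & wt 1 f == n].
Proof.
move=> ak tr.
have cE j : count_mem j.+1 (parts 1 f) = nth 0 f j by rewrite count_parts subn1.
have yk : k - a < k by lia.
have k0 : 0 < k by lia.
rewrite /W_partition /B_partition /is_partition /multiplicities_ok tr yk /=.
rewrite sorted_parts (all_parts 1 f) sumn_parts /=.
have -> : (path (fun u v => u + v < k) (k - a) f) =
    [forall j : 'I_(size (parts 1 f)), (j + (k - 1) < size (parts 1 f)) ==>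
      (nth 0 (parts 1 f) (j + (k - 1)) + 2 <= nth 0 (parts 1 f) j)]
    && (count_mem 1 (parts 1 f) <= a - 1).
  apply/(path_sum_ltP _ yk)/andP => -[].
    move=> h1 h; split; last by rewrite cE; lia.
    apply/difference_condP; [by []|exact: sorted_parts|exact: all_parts|].
    by move=> v; rewrite !cE.
  move=> /(difference_condP k0 (sorted_parts 1 f) (all_parts 1 f)) h.
  rewrite cE => h1; split; first lia.
  by move=> i; have := h i; rewrite !cE.
have -> : all (fun p => ~~ odd p ==> ~~ odd (count_mem p (parts 1 f))) (parts 1 f)
    = even_part_ok f.
  apply/allP/even_part_okP => h.
    move=> i oi; have [il|/count_memPn] := boolP (i.+1 \in parts 1 f).
      by have := h _ il; rewrite /= oi /= cE.
    by rewrite cE => ->.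
  move=> [|i] _; first by rewrite count_parts.
  by rewrite cE; apply/implyP; rewrite /= negbK; apply: h.
by rewrite andbC -!andbA; do !bool_congr.
Qed.

Lemma W_eq_P k a n : 1 <= a <= k -> W k a n = P k a n.
Proof.
move=> ak.
have [ws [uw memw <-]] := W_count k a n; have [ps [up memp <-]] := P_count k a n.
pose phi (L : lpath) := parts 1 (burge L.2).
have inj : {in ps &, injective phi}.
  move=> [y1 s1] [y2 s2]; rewrite !memp !P_pathE.
  move=> /and4P[/eqP-> g1 _ _] /and4P[/eqP-> g2 _ _] e; congr pair.
  by apply: (burge_inj g1 g2); apply: parts_inj e; apply: trimmed_burge.
rewrite -(size_map phi ps); apply/perm_size/uniq_perm; rewrite ?map_inj_in_uniq //.
move=> l; rewrite memw; apply/idP/mapP => [Wl|[[y s] + ->]].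
  have /andP[/andP[Pl _] _] := Wl.
  have [f tf fl] := parts_onto Pl.
  move: Wl; rewrite -fl W_partitionE // => /and3P[ok ev wn].
  have [s gs bs] := burge_onto ok.
  exists (k - a, s); last by rewrite /phi /= bs.
  rewrite memp P_pathE eqxx gs -even_part_ok_burge bs ev /=.
  by rewrite -(@wt_burge k (k - a)) // bs.
rewrite memp P_pathE => /and4P[/eqP-> gs asc mn].
rewrite /phi W_partitionE ?trimmed_burge // multiplicities_ok_burge //=.
by rewrite (even_part_ok_burge false) asc (@wt_burge k (k - a) false).
Qed.

(** * The multiple sum *)

Section MultipleSum.
Local Open Scope ring_scope.

Variables (R : comNzRingType) (q : R) (u : nat -> R).
Hypothesis u0 : u 0%N = 1.
Hypothesis uS : forall j, u j.+1 = u j + q ^+ (2 * j.+1) * u j.+1.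

(** Read sequences as coefficients of powers of z. As the sum of z^j / (q^2; q^2)_j is 1 / (z;
    q^2)_oo, [conv] divides by (z; q^2)_oo and [dconv] by (zq^2; q^2)_oo. *)
Definition conv (m : nat -> R) (N : nat) : R :=
  \sum_(n < N.+1) u (N - n) * m n.

Definition dconv (m : nat -> R) (N : nat) : R :=
  \sum_(n < N.+1) q ^+ (2 * (N - n)) * u (N - n) * m n.

Definition shift (m : nat -> R) (n : nat) : R := if n is n'.+1 then m n' else 0.

Lemma eq_dconv m1 m2 N : m1 =1 m2 -> dconv m1 N = dconv m2 N.
Proof. by move=> h; apply: eq_bigr => i _; rewrite h. Qed.

Lemma dconvD m1 m2 N : dconv (fun n => m1 n + m2 n) N = dconv m1 N + dconv m2 N.
Proof. by rewrite -big_split /=; apply: eq_bigr => i _; rewrite mulrDr. Qed.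

Lemma dconvN m N : dconv (fun n => - m n) N = - dconv m N.
Proof. by rewrite -sumrN; apply: eq_bigr => i _; rewrite mulrN. Qed.

(** Multiplying by 1 - z cancels the first factor of (z; q^2)_oo. *)
Lemma convS m N : conv m N.+1 = conv m N + dconv m N.+1.
Proof.
rewrite /conv /dconv big_ord_recr [in X in _ = _ + X]big_ord_recr /= !subnn u0.
rewrite muln0 expr0 !mul1r addrA; congr (_ + _).
rewrite -big_split /=; apply: eq_bigr => i _.
by rewrite subSn -1?ltnS // {1}uS mulrDl.
Qed.

Lemma dconv_q m N : dconv (fun n => q ^+ (2 * n) * m n) N = q ^+ (2 * N) * conv m N.
Proof.
rewrite /conv mulr_sumr; apply: eq_bigr => i _.
have -> : (2 * N = 2 * (N - i) + 2 * i)%N by have := ltn_ord i; lia.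
by rewrite exprD; ring.
Qed.

Lemma dconv_shift m N : dconv (shift m) N.+1 =
  \sum_(n < N.+1) q ^+ (2 * (N - n)) * u (N - n) * m n.
Proof. by rewrite /dconv big_ord_recl /= mulr0 add0r. Qed.

Lemma dconv_shift1 m N :
  dconv (shift (fun n => q ^+ (2 * n).+1 * m n)) N.+1 = q ^+ (2 * N).+1 * conv m N.
Proof.
rewrite dconv_shift /conv mulr_sumr; apply: eq_bigr => i _.
have -> : ((2 * N).+1 = 2 * (N - i) + (2 * i).+1)%N by have := ltn_ord i; lia.
by rewrite exprD; ring.
Qed.

(** The factor zq^2 - 1 cancels the first factor of (zq^2; q^2)_oo, which leaves minus the series of
    [conv m] at zq^4. *)
Lemma dconv_shift2 m N :
  dconv (fun n => shift (fun n => q ^+ (4 * n).+2 * m n) n - q ^+ (4 * n) * m n) N.+1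
  = - (q ^+ (4 * N.+1) * conv m N.+1).
Proof.
rewrite dconvD dconvN dconv_shift.
pose m' n := q ^+ (2 * n) * m n.
have -> : \sum_(n < N.+1) q ^+ (2 * (N - n)) * u (N - n) * (q ^+ (4 * n).+2 * m n)
    = q ^+ (2 * N.+1) * conv m' N.
  rewrite /conv mulr_sumr; apply: eq_bigr => i _.
  have e : q ^+ (2 * (N - i)) * q ^+ (4 * i).+2 = q ^+ (2 * N.+1) * q ^+ (2 * i).
    by rewrite -!exprD; congr (q ^+ _); have := ltn_ord i; lia.
  rewrite /m'; transitivity (q ^+ (2 * (N - i)) * q ^+ (4 * i).+2 * (u (N - i) * m i)).
    by rewrite mulrACA mulrA.
  by rewrite e; ring.
have -> : dconv (fun n => q ^+ (4 * n) * m n) N.+1 = q ^+ (2 * N.+1) * conv m' N.+1.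
  rewrite -dconv_q; apply: eq_dconv => n.
  by rewrite /m' mulrA -exprD; congr (q ^+ _ * _); lia.
rewrite (convS m') /m' dconv_q mulrDr opprD addrA subrr sub0r mulrA -exprD.
by congr (- (q ^+ _ * _)); lia.
Qed.

(* The part of the multiple sum with N_1 = N, for r = k - 1 and e = a - 1; the
   element [u j] stands for the inverse of (q^2; q^2)_j. *)
Fixpoint msum (r e N : nat) : R :=
  if r is r'.+1 then
    q ^+ (N ^ 2 + (if e is 0%N then 2 * N else 0)) *
    conv (msum r' (if e is e'.+1 then e' else 1)) N
  else (N == 0)%:R.

Lemma msum_0 r e : msum r e 0 = 1.
Proof.
elim: r e => // r IH e /=; rewrite /conv big_ord1 u0 IH !mulr1.
by case: e.
Qed.

(** No index j satisfies e + 1 <= j <= r, so there is no linear term. *)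
Lemma msum_cap (r e N : nat) : (r <= e)%N -> msum r e N = msum r r N.
Proof.
elim: r e N => // r IH [|e] //= N re; congr (_ * _); apply: eq_bigr => n _.
by rewrite IH.
Qed.

(** Boundary case a = 1: without 2N_1 the linear terms are those of a = 3. *)
Lemma msum_rec0 r N : msum r 0 N = q ^+ (2 * N) * msum r 2 N.
Proof.
case: r => [|r] /=; last by rewrite addn0 mulrA -exprD addnC.
by case: N => [|N]; rewrite ?mulr1 ?mulr0.
Qed.

(** Boundary case a = 2, obtained from the case a = 1 one level below. *)
Lemma msum_rec1 r N : msum r.+1 1 N.+1 =
  q ^+ (2 * N.+1) * msum r.+1 3 N.+1 + q ^+ (2 * N).+1 * msum r.+1 1 N.
Proof.
rewrite /= !addn0 convS mulrDr addrC; congr (_ + _).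
  rewrite mulrCA; congr (_ * _); rewrite -dconv_q.
  by apply: eq_dconv => n; apply: msum_rec0.
by rewrite mulrA -exprD; congr (q ^+ _ * _); lia.
Qed.

(** Here a = e + 3. Divided by (zq^2; q^2)_oo, the recursion one level below has (1 - z) C(z) on the
    left and -C(zq^4) as its last term, with C the series of [conv]. The factor q^(N^2) then turns z
    C(z) into zq M(zq^2) and zq C(zq^2) into zq^2 M(zq^4). For e = 0, [msum_rec1] is the recursion
    below, and [msum_rec0] cancels the two remaining terms. *)
Lemma msum_rec (r e N : nat) : (e <= r)%N -> msum r.+2 e.+2 N.+1 =
  q ^+ (2 * N.+1) * (msum r.+2 e.+4 N.+1 + msum r.+2 e N.+1)
  + (q ^+ (2 * N).+1 + q ^+ (4 * N).+2) * msum r.+2 e.+2 N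
  - q ^+ (4 * N.+1) * msum r.+2 e.+2 N.+1.
Proof.
have q1 n : q ^+ (n.+1 ^ 2) = q ^+ (2 * n).+1 * q ^+ (n ^ 2).
  by rewrite -exprD; congr (q ^+ _); lia.
have q2 n : q ^+ (4 * n).+2 = q ^+ (2 * n).+1 * q ^+ (2 * n).+1.
  by rewrite -exprD; congr (q ^+ _); lia.
have q4 n : q ^+ (4 * n) = q ^+ (2 * n) * q ^+ (2 * n).
  by rewrite -exprD; congr (q ^+ _); lia.
elim: e r N => [|e IH] r N er.
  rewrite (msum_rec0 r.+2) q4 q2 /= !addn0 q1.
  pose m := msum r.+1 1; pose mp := msum r.+1 3; rewrite -/m -/mp.
  have h n : m n = q ^+ (2 * n) * mp n + shift (fun n => q ^+ (2 * n).+1 * m n) n.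
    case: n => [|n]; first by rewrite /m /mp !msum_0 mulr1 addr0.
    exact: msum_rec1.
  rewrite [in LHS]convS (eq_dconv _ h) dconvD dconv_q dconv_shift1.
  ring.
case: r er => // r er; have {}IH n := IH r n er.
pose m := msum r.+2 e.+2; pose mp := msum r.+2 e.+4; pose mm := msum r.+2 e.
have unf f n : msum r.+3 f.+1 n = q ^+ (n ^ 2) * conv (msum r.+2 f) n.
  by rewrite [LHS]/= addn0.
rewrite !unf -/m -/mp -/mm q4 q2 q1.
(* At n = 0 this reads 1 = 1 + 0 + 1 + (0 - 1). *)
have h n : m n = q ^+ (2 * n) * mp n + shift (fun n => q ^+ (2 * n).+1 * m n) n
    + q ^+ (2 * n) * mm n
    + (shift (fun n => q ^+ (4 * n).+2 * m n) n - q ^+ (4 * n) * m n).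
  case: n => [|n]; first by rewrite /m /mp /mm !msum_0 /=; ring.
  by rewrite [LHS]IH -/m -/mp -/mm /=; ring.
rewrite [in LHS]convS (eq_dconv _ h) !dconvD !dconv_q dconv_shift1.
have := dconv_shift2 m N; rewrite dconvD => ->; rewrite q4.
ring.
Qed.

End MultipleSum.

(** * Generating functions of paths *)

(** The empty path is kept apart because an East step must be followed by another step. *)
Fixpoint nonempty_paths (k l : nat) (p e : bool) (y : nat) : seq (seq step) :=
  if l is l'.+1 then
    (if (y.+1 < k) && (p || ~~ e)
     then map (cons NorthEast) (nonempty_paths k l' true (~~ e) y.+1) else [::]) ++
    (if y is y'.+1
     then map (cons SouthEast)
       (nseq (y' == 0) [::] ++ nonempty_paths k l' false (~~ e) y')
     else map (cons East) (nonempty_paths k l' false (~~ e) 0))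
  else [::].

Definition paths (k l : nat) (p e : bool) (y : nat) : seq (seq step) :=
  nseq (y == 0) [::] ++ nonempty_paths k l p e y.

Lemma mem_map_cons (c d : step) (s : seq step) (X : seq (seq step)) :
  (d :: s \in map (cons c) X) = (d == c) && (s \in X).
Proof.
apply/mapP/andP => [[t tX [-> ->]]|[/eqP-> sX]]; first by rewrite eqxx.
by exists s.
Qed.

Lemma nil_map_cons (c : step) (X : seq (seq step)) : ([::] \in map (cons c) X) = false.
Proof. by apply/mapP => -[]. Qed.

Lemma mem_nonempty_paths k l p e y s : y < k ->
  (s \in nonempty_paths k l p e y) =
  [&& s != [::], good_path k y s, ascents_at p e s & size s <= l].
Proof.
have gk z t : good_path k z t -> z < k by case: t => [|c t] /= /andP[].
elim: l p e y s => [|l IH] p e y s yk /=.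
  by rewrite in_nil; case: s => //= c s; rewrite !andbF.
rewrite mem_cat; case: s => [|c s] /=.
  have -> : [::] \in (if (y.+1 < k) && (p || ~~ e)
     then map (cons NorthEast) (nonempty_paths k l true (~~ e) y.+1) else [::]) = false.
    by case: ifP => // _; apply: nil_map_cons.
  by case: y {yk} => [|y] /=; rewrite nil_map_cons.
rewrite yk ltnS /=.
have memP b z t : z < k -> (t \in nseq (z == 0) [::] ++ nonempty_paths k l b (~~ e) z) =
    [&& good_path k z t, ascents_at b (~~ e) t & size t <= l].
  move=> zk; rewrite mem_cat IH // mem_nseq; case: t => [|d t] /=.
    by rewrite zk eqxx andbT orbF; case: eqP.
  by rewrite andbF.
case: c => /=.
- have -> : (NorthEast :: s \in (if (y.+1 < k) && (p || ~~ e)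
     then map (cons NorthEast) (nonempty_paths k l true (~~ e) y.+1) else [::])) =
     [&& p || ~~ e, good_path k y.+1 s, ascents_at true (~~ e) s & size s <= l].
    case: (p || ~~ e); last by rewrite andbF.
    rewrite andbT /=; case: ifP => [yk'|/negP nyk].
      by rewrite mem_map_cons eqxx /= -(memP true y.+1).
    by rewrite in_nil; apply/esym/negP => /andP[/gk].
  have -> : NorthEast :: s \in (if y is y'.+1
     then map (cons SouthEast)
       (nseq (y' == 0) [::] ++ nonempty_paths k l false (~~ e) y')
     else map (cons East) (nonempty_paths k l false (~~ e) 0)) = false.
    by case: (y) => [|y']; rewrite mem_map_cons.
  by rewrite orbF /=; case: (p || ~~ e); rewrite ?andbF.
- have -> : SouthEast :: s \in (if (y.+1 < k) && (p || ~~ e)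
     then map (cons NorthEast) (nonempty_paths k l true (~~ e) y.+1) else [::]) = false.
    by case: ifP => // _; rewrite mem_map_cons.
  case: y yk => [|y] yk /=; first by rewrite mem_map_cons.
  by rewrite mem_map_cons /= memP // ltnW.
- have -> : East :: s \in (if (y.+1 < k) && (p || ~~ e)
     then map (cons NorthEast) (nonempty_paths k l true (~~ e) y.+1) else [::]) = false.
    by case: ifP => // _; rewrite mem_map_cons.
  case: y yk => [|y] yk /=; last by rewrite mem_map_cons.
  by rewrite mem_map_cons /= IH // -!andbA.
Qed.

Lemma mem_paths k l p e y s : y < k ->
  (s \in paths k l p e y) = [&& good_path k y s, ascents_at p e s & size s <= l].
Proof.
move=> yk; rewrite mem_cat mem_nonempty_paths // mem_nseq.
case: s => [|c s] /=; last by rewrite andbF.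
by rewrite yk eqxx andbT orbF; case: eqP.
Qed.

Lemma nil_notin_nonempty_paths k l p e y : [::] \notin nonempty_paths k l p e y.
Proof.
case: l => [|l] //=; rewrite mem_cat negb_or; apply/andP; split.
  by case: ifP => // _; rewrite nil_map_cons.
by case: y => [|y]; rewrite nil_map_cons.
Qed.

Lemma uniq_cat_nil X (z : bool) : [::] \notin X -> uniq X -> uniq (nseq z ([::] : seq step) ++ X).
Proof. by case: z => //= -> ->. Qed.

Lemma uniq_nonempty_paths k l p e y : uniq (nonempty_paths k l p e y).
Proof.
have consI (c : step) : injective (cons c) by move=> s t [].
elim: l p e y => //= l IH p e y; rewrite cat_uniq; apply/and3P; split.
- by case: ifP => // _; rewrite map_inj_uniq.
- apply/hasPn => s; case: ifP => [_|]; last by rewrite in_nil.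
  case: s => [|c s]; first by rewrite nil_map_cons.
  case: y => [|y] /=; rewrite !mem_map_cons => /andP[/eqP-> _]; apply/negP;
    by case/andP.
- case: y => [|y] /=; rewrite map_inj_uniq //.
  by apply: uniq_cat_nil => //; apply: nil_notin_nonempty_paths.
Qed.

Lemma uniq_paths k l p e y : uniq (paths k l p e y).
Proof.
apply: uniq_cat_nil; last exact: uniq_nonempty_paths.
exact: nil_notin_nonempty_paths.
Qed.

Lemma leq_pk_size p s : pk p s <= size s.
Proof. by elim: s p => //= c s IH p; rewrite -add1n leq_add // leq_b1. Qed.

(** * Path series graded by the number of peaks *)

Section PathSum.
Local Open Scope ring_scope.

Variables (R : comNzRingType) (q : R) (k : nat).

Definition psum (X : seq (seq step)) (p : bool) (N : nat) : R :=
  \sum_(s <- X | pk p s == N) q ^+ mj p s.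

Definition gsum (l : nat) (p e : bool) (y N : nat) : R :=
  psum (paths k l p e y) p N.

Lemma psum_cat X Y p N : psum (X ++ Y) p N = psum X p N + psum Y p N.
Proof. exact: big_cat. Qed.

Lemma psum_nil1 (z p : bool) N : psum (nseq z [::]) p N = (z && (N == 0%N))%:R.
Proof.
case: z; last by rewrite /psum big_nil.
by rewrite /psum big_cons big_nil /= eq_sym; case: eqP; rewrite ?addr0.
Qed.

Lemma psum_cons c X p N : ~~ (p && (c == SouthEast)) ->
  psum (map (cons c) X) p N = q ^+ N * psum X (c == NorthEast) N.
Proof.
move=> /negPf pc; rewrite /psum big_map mulr_sumr; apply: eq_big => s /=; rewrite pc //.
by rewrite add0n => /eqP <-; rewrite -exprD addnC.
Qed.

(** The new peak has weight 0; the other N' peaks move one unit to the right. *)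
Lemma psum_peak X N : psum (map (cons SouthEast) X) true N =
  if N is N'.+1 then q ^+ N' * psum X false N' else 0.
Proof.
rewrite /psum big_map /=; case: N => [|N]; first by rewrite big_pred0.
rewrite mulr_sumr; apply: eq_big => s //=.
by rewrite add1n eqSS => /eqP->; rewrite -exprD addnC.
Qed.

Lemma gsumS (l : nat) (p e : bool) (y N : nat) : (p <= y)%N ->
  gsum l.+1 p e y N =
  (if (y.+1 < k)%N && (p || ~~ e) then q ^+ N * gsum l true (~~ e) y.+1 N else 0)
  + (if p then (if N is N'.+1 then q ^+ N' * gsum l false (~~ e) y.-1 N' else 0)
     else q ^+ N * gsum l false (~~ e) y.-1 N).
Proof.
move=> py; rewrite /gsum {1}/paths psum_cat psum_nil1 [nonempty_paths _ _ _ _ _]/=.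
rewrite psum_cat addrCA; congr (_ + _).
  by case: ifP => _; [rewrite psum_cons ?andbF|rewrite /psum big_nil].
case: y py => [|y] py /=.
  (* At height 0 the empty path makes up for the forbidden single East step: both would contribute 1
     to N = 0. *)
  case: p py => // _; rewrite psum_cons // /paths psum_cat psum_nil1 mulrDr.
  by case: N => [|N]; rewrite ?mulr1 ?mulr0.
rewrite add0r; case: p {py}; first exact: psum_peak.
by rewrite psum_cons.
Qed.

(** Only the straight descent, of y steps, has no peak; after a North-East step a peak is
    unavoidable. *)
Lemma gsum_0 (l : nat) (p e : bool) (y : nat) : (p <= y)%N -> (y < k)%N ->
  (p || (y <= l)%N) -> gsum l p e y 0 = (~~ p)%:R.
Proof.
elim: l p e y => [|l IH] p e y py yk pl.
  rewrite /gsum /paths psum_cat psum_nil1 /= /psum big_nil addr0 andbT.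
  by case: p py pl => //=; [case: y {yk}|rewrite leqn0 => _ ->].
rewrite gsumS // !expr0 !mul1r.
have -> : (if (y.+1 < k)%N && (p || ~~ e) then gsum l true (~~ e) y.+1 0 else 0) = 0.
  by case: ifP => // /andP[yk' _]; rewrite IH.
by rewrite add0r; case: p py pl => //= _ pl; rewrite IH //; lia.
Qed.

(* Two steps at a time, the parity of the weight is restored. *)
Lemma gsumSS (l : nat) (p : bool) (y N : nat) : (p <= y)%N ->
  gsum l.+2 p false y N.+1 =
  (if (y.+1 < k)%N then
     (if (y.+2 < k)%N then q ^+ (2 * N.+1) * gsum l true false y.+2 N.+1 else 0)
     + q ^+ (2 * N).+1 * gsum l false false y N else 0)
  + (if p then q ^+ (2 * N) * gsum l false false y.-2 N
     else q ^+ (2 * N.+1) * gsum l false false y.-2 N.+1).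
Proof.
move=> py; rewrite gsumS // orbT andbT; congr (_ + _).
  case: ifP => // _; rewrite gsumS // andbT mulrDr; congr (_ + _).
    by case: ifP => _; rewrite ?mulr0 // mulrA -exprD; congr (q ^+ _ * _); lia.
  by rewrite mulrA -exprD; congr (q ^+ _ * _); lia.
case: p {py}; rewrite gsumS //= andbF add0r mulrA -exprD;
  by congr (q ^+ _ * _); lia.
Qed.

End PathSum.

(** * Path series as multiple sums *)

Section PathSumMultipleSum.
Local Open Scope ring_scope.

Variables (R : comNzRingType) (q : R) (u : nat -> R).
Hypothesis u0 : u 0%N = 1.
Hypothesis uS : forall j, u j.+1 = u j + q ^+ (2 * j.+1) * u j.+1.
Variables (B r : nat).
Hypothesis qB : q ^+ B = 0.

Local Notation D l := (gsum q r.+1 l false false).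
Local Notation U l := (gsum q r.+1 l true false).
Local Notation M := (msum q u r).

(* As q^B = 0, the factor q^j allows equality up to the order to which paths of
   at most l steps determine the series.  Paths that follow a North-East step
   have U(z) = D(z) + (z - 1) D'(zq^2), with D' for a start two units lower: the
   two series differ only on the paths whose first step is not North-East. *)
Lemma gsum_msum (l j y N : nat) : (y <= r)%N -> (B + r < j + l)%N ->
  q ^+ j * D l y N = q ^+ j * M (r - y) N /\
  ((0 < y)%N -> q ^+ j * U l y N.+1 =
     q ^+ j * (M (r - y) N.+1 - q ^+ (2 * N.+1) * M (r - y.-2) N.+1
              + q ^+ (2 * N) * M (r - y.-2) N)).
Proof.
have big i x : (B <= i)%N -> q ^+ i * x = 0.
  by move=> /subnK <-; rewrite exprD qB mulr0 mul0r.
have [n] := ubnP l; elim: n l j y N => // n IH l j y N ln yr jl.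
have [jB|Bj] := ltnP j B; last by rewrite !big.
(* From j < B follows l >= r + 2, so two steps can be removed. *)
case: l ln jl => [|[|l]] ln jl; [lia|lia|].
have D0 z : (z <= r)%N -> D l z 0 = M (r - z) 0.
  by move=> zr; rewrite gsum_0 ?msum_0 //; lia.
(* The two removed steps are paid for by q^i with i >= 2; for m = 0 the value is known outright. *)
have IHD i z m : (z <= r)%N -> (m = 0%N \/ 2 <= i)%N ->
    q ^+ (j + i) * D l z m = q ^+ (j + i) * M (r - z) m.
  move=> zr [->|i2]; first by rewrite D0.
  by apply: (proj1 (IH l (j + i)%N z m _ zr _)); lia.
have IHU i z m : (0 < z <= r)%N -> (2 <= i)%N -> q ^+ (j + i) * U l z m.+1 =
     q ^+ (j + i) * (M (r - z) m.+1 - q ^+ (2 * m.+1) * M (r - z.-2) m.+1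
              + q ^+ (2 * m) * M (r - z.-2) m).
  move=> /andP[z0 zr] i2; apply: (proj2 (IH l (j + i)%N z m _ zr _)) => //; lia.
have yr2 : (y.-2 <= r)%N by lia.
have DE m : q ^+ j * D l.+2 y m = q ^+ j * M (r - y) m.
  case: m => [|m]; first by rewrite gsum_0 ?msum_0 //; lia.
  (* For y < 2 the truncated [y.-2] is 0, and both indices are at least r. *)
  have cap : M (r - y.-2) m.+1 = M (r - y).+2 m.+1.
    have [y2|y2] := leqP 2 y; first by congr (M _ _); lia.
    have -> : (r - y.-2 = r)%N by lia.
    by rewrite [RHS]msum_cap //; lia.
  rewrite gsumSS // mulrDr [in X in _ + X]mulrA -exprD IHD //; last by lia.
  rewrite cap.
  (* The cases y = r, y = r - 1 and y <= r - 2 are a = 1, a = 2 and a >= 3 of the recursion. *)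
  have [yr1|ry] := ltnP y.+1 r.+1; last first.
    have -> : (r - y = 0)%N by lia.
    by rewrite mulr0 add0r exprD -mulrA [in RHS]msum_rec0.
  rewrite [in X in X + _]mulrDr [in X in _ + X + _]mulrA -exprD IHD //; last first.
    by case: (m) => [|m']; [left|right; lia].
  have [yr3|ry] := ltnP y.+2 r.+1; last first.
    rewrite mulr0 add0r !exprD -!mulrA -!mulrDr; congr (_ * _).
    have e1 : (r - y = 1)%N by lia.
    by rewrite e1; case: (r) (yr1) => // r' _; rewrite (msum_rec1 u0 uS) addrC.
  rewrite [in X in X + _ + _]mulrA -exprD IHU //; last lia.
  have -> : (y.+2.-2 = y)%N by [].
  rewrite !(exprD q j) -!mulrA -!mulrDr; congr (_ * _).
  have [r' [e [re ee er]]] : exists r' e, [/\ r = r'.+2, r - y = e.+2 & e <= r']%N.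
    by exists (r - 2)%N, (r - y - 2)%N; split; lia.
  have -> : (r - y.+2 = e)%N by lia.
  rewrite ee re [in RHS](msum_rec u0 uS _ er).
  have q4 : q ^+ (4 * m.+1) = q ^+ (2 * m.+1) * q ^+ (2 * m.+1).
    by rewrite -exprD; congr (q ^+ _); lia.
  have q2 : q ^+ (4 * m).+2 = q ^+ (2 * m.+1) * q ^+ (2 * m).
    by rewrite -exprD; congr (q ^+ _); lia.
  by rewrite q4 q2; ring.
split=> // y0.
have UD : U l.+2 y N.+1 = D l.+2 y N.+1 - q ^+ (2 * N.+1) * D l y.-2 N.+1
    + q ^+ (2 * N) * D l y.-2 N.
  by rewrite !gsumSS //; ring.
rewrite UD !mulrDr DE mulrN !mulrA -!exprD IHD //; last lia.
rewrite IHD // ?mulrN ?mulrA -?exprD //.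
by lia.
Qed.

End PathSumMultipleSum.

(** * Summation over the decreasing sequences *)

Fixpoint decreasing_lists (r N : nat) : seq (seq nat) :=
  if r is r'.+1 then
    flatten [seq map (cons n) (decreasing_lists r' n) | n <- iota 0 N.+1]
  else [:: [::]].

Lemma mem_decreasing_lists r N l :
  (l \in decreasing_lists r N) = [&& size l == r, sorted geq l & head 0 l <= N].
Proof.
elim: r N l => [|r IH] N l; first by rewrite inE; case: l.
apply/flatten_mapP/and3P => [[n + /mapP[l' + ->]]|].
  rewrite mem_iota IH /= => nN /and3P[/eqP-> sl hl]; split=> //.
  by case: l' sl hl => //= x l' -> ->.
case: l => [|x l] [sz sl xN] //; exists x; first by rewrite mem_iota.
apply/mapP; exists l => //; rewrite IH -eqSS sz /=.
by case: l sl {sz xN} => //= y l /andP[-> ->].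
Qed.

Lemma uniq_decreasing_lists r N : uniq (decreasing_lists r N).
Proof.
elim: r N => // r IH N; apply: allpairs_uniq_dep => [|n _|].
- exact: iota_uniq.
- exact: IH.
- by move=> [n l] [n' l'] _ _ /= [-> ->].
Qed.

Definition list_exponent (a : nat) (l : seq nat) : nat :=
  (\sum_(1 <= j < (size l).+1) nth 0 l j.-1 ^ 2
   + \sum_(a <= j < (size l).+1 | j == a %[mod 2]) 2 * nth 0 l j.-1)%N.

(** Dropping the first entry lowers all indices by one. When a = 1, the next index with a linear
    term is 3, which becomes 2. *)
Lemma list_exponent_cons (e x : nat) (l : seq nat) :
  list_exponent e.+1 (x :: l) =
  (x ^ 2 + (if e is 0 then 2 * x else 0) +
   list_exponent (if e is e'.+1 then e else 2) l)%N.
Proof.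
rewrite /list_exponent /= big_nat_recl // [in X in _ + X + _]big_add1 /=.
have -> : \sum_(e.+1 <= j < (size l).+2 | j == e.+1 %[mod 2]) 2 * nth 0%N (x :: l) j.-1
  = (if e is 0 then 2 * x else 0) + \sum_((if e is e'.+1 then e else 2) <= j < (size l).+1
      | j == (if e is e'.+1 then e else 2) %[mod 2]) 2 * nth 0%N l j.-1.
  have md i m : (i.+1 == m.+1 %[mod 2]) = (i == m %[mod 2]).
    by rewrite -(addn1 i) -(addn1 m) eqn_modDr.
  case: e => [|e].
    rewrite big_ltn_cond // eqxx big_add1; congr addn.
    case: l => [|y l]; first by rewrite !big_geq.
    rewrite [size _]/= big_ltn_cond // md.
    have -> : (1 == 0 %[mod 2]) = false by [].
    rewrite [LHS]big_nat_cond [RHS]big_nat_cond; apply: eq_big => [i|[|i] //].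
    by rewrite md -(modnDr 0 2).
  rewrite big_add1 add0n [LHS]big_nat_cond [RHS]big_nat_cond; apply: eq_big => [i|[|i] //].
  by rewrite md.
by rewrite [\sum_(1 <= j < _) _]big_add1 addnACA.
Qed.

Section Terms.
Local Open Scope ring_scope.

Variables (R : comNzRingType) (q : R) (u : nat -> R).

Fixpoint qterm (e : nat) (l : seq nat) : R :=
  if l is N :: l' then
    q ^+ (N ^ 2 + (if e is 0%N then 2 * N else 0)) * u (N - head 0%N l') *
    qterm (if e is e'.+1 then e' else 1) l'
  else 1.

(** An arbitrary [phi] lets the induction absorb the factor u (n - i) of the convolution. *)
Lemma sum_msum (r e N : nat) (phi : nat -> R) :
  \sum_(n < N.+1) phi n * msum q u r e n =
  \sum_(l <- decreasing_lists r N) phi (head 0%N l) * qterm e l.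
Proof.
elim: r e N phi => [|r IH] e N phi.
  rewrite big_ord_recl /= big_seq1 big1 ?addr0 // => i _.
  by rewrite mulr0.
rewrite -[decreasing_lists r.+1 N]/(flatten
  [seq map (cons n) (decreasing_lists r n) | n <- iota 0 N.+1]).
rewrite big_flatten big_map.
rewrite -(big_mkord xpredT (fun n => phi n * msum q u r.+1 e n)) /index_iota subn0.
apply: eq_bigr => n _; rewrite big_map /= /conv mulr_sumr.
transitivity (\sum_(i < n.+1) phi n * q ^+ (n ^ 2 + (if e is 0%N then 2 * n else 0))
   * u (n - i) * msum q u r (if e is e'.+1 then e' else 1) i).
  by rewrite mulr_sumr; apply: eq_bigr => i _; rewrite !mulrA.
rewrite (IH _ _ (fun i => phi n * q ^+ _ * u (n - i))).
by apply: eq_bigr => l _; rewrite !mulrA.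
Qed.

Lemma qtermE (e : nat) (l : seq nat) : qterm e l =
  q ^+ list_exponent e.+1 l * \prod_(1 <= j < (size l).+1) u (nth 0%N l j.-1 - nth 0%N l j).
Proof.
elim: l e => [|x l IH] e.
  by rewrite /list_exponent /= !big_geq // mulr1.
rewrite list_exponent_cons exprD big_ltn // big_add1.
have -> : \prod_(1 <= i < (size (x :: l)).+1.-1)
    u (nth 0%N (x :: l) i.+1.-1 - nth 0%N (x :: l) i.+1)
    = \prod_(1 <= j < (size l).+1) u (nth 0%N l j.-1 - nth 0%N l j).
  by rewrite big_nat [RHS]big_nat; apply: eq_bigr => -[|i].
by case: e => [|e]; rewrite /= IH -nth0 mulrACA.
Qed.

End Terms.

(** * Extraction of coefficients *)

Section Truncation.
Local Open Scope ring_scope.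

Variable n : nat.

Local Notation trunc := (in_qpoly ('X^(n.+1) : {poly int})).

(** Modulo X^(n+1) the variable is nilpotent and polynomials with constant term 1 are invertible,
    while the coefficient of X^n is kept. *)
Definition qvar := trunc 'X.
Definition qcoef (x : {poly %/ ('X^(n.+1) : {poly int})}) : int := (x : {poly int})`_n.

Lemma qcoef_trunc (p : {poly int}) : qcoef (trunc p) = p`_n.
Proof.
rewrite /qcoef.
rewrite /in_qpoly /= (mk_monic_Xn _ n.+1) /=.
rewrite [in RHS](Pdiv.RingMonic.rdivp_eq (monicXn _ n.+1) p).
by rewrite coefD coefMXn ltnSn add0r.
Qed.

Lemma qvarXn : qvar ^+ n.+1 = 0.
Proof.
rewrite /qvar.
rewrite -rmorphXn /=; apply/val_inj => /=.
by rewrite (mk_monic_Xn _ n.+1) /= Pdiv.RingMonic.rmodpp ?monicXn.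
Qed.

Definition inv_trunc (d : {poly int}) : {poly int} := \sum_(m < n.+1) (1 - d) ^+ m.

(** The geometric sum gives 1 - (1 - d)^(n+1), and X divides 1 - d. *)
Lemma mul_inv_trunc (d : {poly int}) : d`_0 = 1 -> trunc d * trunc (inv_trunc d) = 1.
Proof.
move=> d0; rewrite -rmorphM /=.
have -> : d * inv_trunc d = 1 - (1 - d) ^+ n.+1.
  have := subrXX 1 (1 - d) n.+1; rewrite expr1n subKr => ->.
  by congr (_ * _); apply: eq_bigr => i _; rewrite expr1n mul1r.
have /factor_theorem[e ->] : root (1 - d) 0.
  by rewrite /root horner_coef0 coefB coef1 d0 subrr.
rewrite subr0 rmorphB rmorph1 rmorphXn rmorphM exprMn /= qvarXn mulr0.
by rewrite subr0.
Qed.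

Lemma trunc_inv_uniq (d : {poly int}) (x : {poly %/ ('X^(n.+1) : {poly int})}) :
  d`_0 = 1 -> trunc d * x = 1 -> x = trunc (inv_trunc d).
Proof.
by move=> d0 dx; rewrite -[LHS]mul1r -(mul_inv_trunc d0) mulrAC dx mul1r.
Qed.

Lemma q2_poch0 m : (q2_poch m)`_0 = 1.
Proof.
rewrite -horner_coef0 /q2_poch horner_prod big_nat big1 // => i ib.
rewrite !hornerE expr0n; have -> : (2 * i == 0)%N = false by lia.
by rewrite subr0.
Qed.

Definition uq (j : nat) := trunc (inv_trunc (q2_poch j)).

Lemma uq0 : uq 0 = 1.
Proof.
have := mul_inv_trunc (q2_poch0 0).
have p0 : q2_poch 0 = 1 by rewrite /q2_poch big_geq.
by rewrite /uq p0 rmorph1 mul1r.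
Qed.

Lemma uqS j : uq j.+1 = uq j + qvar ^+ (2 * j.+1) * uq j.+1.
Proof.
apply/eqP; rewrite -subr_eq -{1}[uq j.+1]mul1r -mulrBl mulrC; apply/eqP.
apply: (trunc_inv_uniq (q2_poch0 j)).
have := mul_inv_trunc (q2_poch0 j.+1); rewrite -/(uq _).
rewrite {1}/q2_poch big_nat_recr //= -/(q2_poch j) rmorphM rmorphB rmorph1 rmorphXn /=.
by rewrite -mulrA [_ * uq _]mulrC.
Qed.

Lemma trunc_prod_uq (r : nat) (f : nat -> nat) :
  \prod_(1 <= j < r) uq (f j) = trunc (inv_trunc (\prod_(1 <= j < r) q2_poch (f j))).
Proof.
apply: trunc_inv_uniq => //.
  rewrite -horner_coef0 horner_prod big1 // => i _.
  by rewrite horner_coef0 q2_poch0.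
rewrite rmorph_prod -big_split big1 //= => i _.
exact: mul_inv_trunc (q2_poch0 _).
Qed.

Lemma qcoef_sum I (s : seq I) (P : pred I) (F : I -> {poly %/ ('X^(n.+1) : {poly int})}) :
  qcoef (\sum_(i <- s | P i) F i) = \sum_(i <- s | P i) qcoef (F i).
Proof. by rewrite /qcoef poly_of_qpoly_sum coef_sum. Qed.

End Truncation.

(** * Comparison of the coefficients of q^n *)

Lemma summandE k a n (N : (k - 1).-tuple nat) : 0 < k -> 0 < a ->
  summand a N n = qcoef (qterm (qvar n) (uq n) a.-1 N).
Proof.
move=> k0 a0; rewrite /summand /series_div -[(\sum_(m < n.+1) _)%R]/(inv_trunc n _).
rewrite -qcoef_trunc rmorphM rmorphXn /= qtermE prednK //.
have sz : (size N).+1 = k by rewrite size_tuple subn1 prednK.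
rewrite /list_exponent sz -/(exponent a N).
by rewrite (trunc_prod_uq n k (fun j => nth 0 N j.-1 - nth 0 N j)).
Qed.

(** The length bound loses no path of major index n, and it bounds the number N of peaks. *)
Lemma P_gsum k a n : 1 <= a <= k ->
  ((P k a n)%:Z = \sum_(N < (n + k).+2)
     qcoef (gsum (qvar n) k (n + k).+1 false false (k - a) N))%R.
Proof.
move=> ak; have yk : k - a < k by lia.
pose X := paths k (n + k).+1 false false (k - a).
have -> : P k a n = count (fun s => mj false s == n) X.
  have [ps [up memp <-]] := P_count k a n.
  rewrite -size_filter -(size_map (pair (k - a)) (filter _ X)); apply/perm_size/uniq_perm => //.
    by rewrite map_inj_uniq ?filter_uniq ?uniq_paths // => s t [].
  move=> [y s]; rewrite memp P_pathE; apply/and4P/mapP => [[/eqP-> gs asc mn]|].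
    exists s => //; rewrite mem_filter mn mem_paths // gs asc /=.
    have PL : P_path k a n (k - a, s) by rewrite P_pathE eqxx gs asc mn.
    by have := P_path_size PL => /=; lia.
  case=> t; rewrite mem_filter mem_paths // => /and4P[mn gs asc _] [-> ->].
  by rewrite eqxx.
transitivity (\sum_(s <- X) qcoef (qvar n ^+ mj false s))%R.
  rewrite -sum1_count -natz natr_sum big_mkcond /=; apply: eq_bigr => s _.
  rewrite -rmorphXn /= qcoef_trunc coefXn eq_sym.
  by case: eqP.
rewrite /gsum /psum; under [RHS]eq_bigr do rewrite qcoef_sum.
rewrite (exchange_big_dep xpredT) //= big_seq [RHS]big_seq; apply: eq_bigr => s.
rewrite mem_paths // => /and3P[_ _ szs].
have pks : pk false s < (n + k).+2 by rewrite ltnS (leq_trans (leq_pk_size _ _)).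
by rewrite (big_pred1 (Ordinal pks)).
Qed.

Theorem theorem1p10 (k a : nat) (hk : 2 <= k) (ha : 1 <= a <= k) :
  (forall n : nat, W k a n = P k a n) /\
  series_sum (fun N : (k - 1).-tuple nat => sorted geq N)
    (summand a) (fun n : nat => (P k a n)%:Z%R).
Proof.
split=> [n|n]; first exact: W_eq_P.
pose L := decreasing_lists (k - 1) (n + k).+1.
pose G l : int := qcoef (qterm (qvar n) (uq n) a.-1 l).
have PG : (P k a n)%:Z%R = (\sum_(l <- L) G l)%R.
  rewrite P_gsum // -qcoef_sum.
  transitivity (qcoef (\sum_(N < (n + k).+2) msum (qvar n) (uq n) (k - 1) a.-1 N)%R).
    congr (qcoef _); apply: eq_bigr => N _.
    have e : k = (k - 1).+1 by lia.
    (* With B = n + 1, r = k - 1 and j = 0, the length n + k + 1 just exceeds B + r. *)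
    have [||+ _] := @gsum_msum _ (qvar n) (uq n) (uq0 n) (uqS n) n.+1 (k - 1)
      (qvarXn n) (n + k).+1 0 (k - a) N; [lia|lia|].
    rewrite -e !expr0 !mul1r => ->.
    by congr (msum _ _ _ _ _); lia.
  have := sum_msum (qvar n) (uq n) (k - 1) a.-1 (n + k).+1 (fun _ => 1%R).
  under eq_bigr do rewrite mul1r; move=> ->.
  rewrite qcoef_sum; apply: eq_bigr => l _.
  by rewrite mul1r.
(* Outside [L] the first entry exceeds n + k + 1, so q^(N_1^2) vanishes. *)
have G0 l : size l = k - 1 -> sorted geq l -> l \notin L -> G l = 0%R.
  move=> sz sl; rewrite mem_decreasing_lists sz eqxx sl /= -ltnNge.
  case: l sz sl => [|x l] sz sl /= nx; first by lia.
  have nx2 : n < x ^ 2 by nia.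
  by rewrite /G /= -(subnK nx2) -addnA addnCA exprD qvarXn !mul0r /qcoef /= coef0.
(* The members of [L] as tuples; any further decreasing tuple adds 0. *)
exists (pmap insub L) => [|t ut st sub].
  apply/allP => N; rewrite mem_pmap_sub mem_decreasing_lists.
  by case/and3P.
have k0 : 0 < k by lia.
have a0 : 0 < a by lia.
rewrite PG; under eq_bigr do rewrite summandE //.
rewrite -(big_map val xpredT G).
have ut' : uniq (map val t) by rewrite (map_inj_uniq val_inj).
rewrite (bigID (mem L)) /= [X in (_ + X)%R]big_seq_cond [X in (_ + X)%R]big1 ?addr0; last first.
  move=> l /andP[/mapP[N Nt ->]]; apply: G0; first by rewrite size_tuple.
  exact: (allP st).
rewrite -big_filter; apply/perm_big/uniq_perm; rewrite ?filter_uniq ?uniq_decreasing_lists //.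
move=> l; rewrite mem_filter /=; apply/andP/idP => [[]//|lL]; split=> //.
have sz : size l == k - 1 by move: lL; rewrite mem_decreasing_lists => /and3P[].
by apply/mapP; exists (Tuple sz) => //; apply: sub; rewrite mem_pmap_sub.
Qed.
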